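(* Let $N\ge 2$ and assume that $\Omega\subset\mathbb{R}^N$ is a domain in the hyperbolic case (defined in the context). For any $\varepsilon>0$, $\varepsilon\ll 1$, there exists a constant $C(\Omega,\varepsilon)$ such that the following inequality holds: $$C(\Omega,\varepsilon)\int_\Omega v^2\,dx+\int_\Omega|\nabla v|^2\,dx\ \ge\ \Big(\frac{N^2}{4}-\varepsilon\Big)\int_\Omega\frac{v^2}{|x|^2}\,dx\qquad\text{for all } v\in H_0^1(\Omega).$$ Moreover, this inequality is optimal in the sense that the term in $L^2$-norm on its left-hand side cannot be disregarded.
   Context: Points of $\mathbb{R}^N$ are written $x=(x',x_N)$ with $x'=(x_1,\dots,x_{N-1})$; for $\gamma\in\mathbb{R}$, $P_\gamma=\{x\in\mathbb{R}^N : x_N>\gamma|x'|^2\}$. Throughout, $\Omega$ is a Lipschitz domain with $0\in\partial\Omega$ whose boundary is smooth around the origin; up to a rotation, the boundary near the origin is written as $x_N=\sum_{i=1}^{N-1}\alpha_i x_i^2+o(|x'|^2)$ as $|x'|\to 0$, where $\alpha_1,\dots,\alpha_{N-1}$ are the principal curvatures of $\partial\Omega$ at $0$. The hyperbolic case corresponds to the situation when $\Omega$ has a hyperbolic geometry near the origin $x=0$; accordingly, it is supposed that $\Omega\subset P_\gamma$ for some $\gamma<0$. *)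

(* Defs.v *)
From HB Require Import structures.
From mathcomp Require Import all_boot all_order all_algebra.
From mathcomp Require Import all_classical all_reals all_analysis.
Import Order.TTheory GRing.Theory Num.Theory.
Import numFieldNormedType.Exports.

Set Implicit Arguments.
Unset Strict Implicit.
Unset Printing Implicit Defensive.

Local Open Scope classical_set_scope.
Local Open Scope ring_scope.

(* Row vectors carry the sigma-algebra generated by the coordinates, as
   n.-tuple does in the library; over R this is the Borel sigma-algebra. *)
Section measurable_row.
Context {d} {T : measurableType d}.
Variable n : nat.

Let coors : 'I_n -> 'rV[T]_n -> T := fun i x => x 0 i.

Let row_set0 : g_sigma_preimage coors set0.
Proof. exact: sigma_algebra0. Qed.

Let row_setC A : g_sigma_preimage coors A -> g_sigma_preimage coors (~` A).
Proof. exact: sigma_algebraC. Qed.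

Let row_bigcup (F : _^nat) : (forall i, g_sigma_preimage coors (F i)) ->
  g_sigma_preimage coors (\bigcup_i (F i)).
Proof. exact: sigma_algebra_bigcup. Qed.

HB.instance Definition _ := @isMeasurable.Build (measure_tuple_display d)
  'rV[T]_n (g_sigma_preimage coors) row_set0 row_setC row_bigcup.

End measurable_row.

Lemma measurable_coord d (T : measurableType d) n (i : 'I_n) :
  measurable_fun [set: 'rV[T]_n] (fun x => x 0 i).
Proof.
move=> _ Y mY; rewrite setTI; apply: sub_sigma_algebra => /=.
rewrite -bigcup_seq/=; exists i => /=; first by rewrite mem_index_enum.
by exists Y => //; rewrite setTI.
Qed.

Lemma measurable_fun_coordP d1 d2 (T1 : measurableType d1)
    (T2 : measurableType d2) n (f : T1 -> 'rV[T2]_n) :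
  (forall i, measurable_fun [set: T1] (fun x => f x 0 i)) ->
  measurable_fun [set: T1] f.
Proof.
move=> mf; apply: measurability; first by reflexivity.
move=> _ [B + <-]; rewrite -bigcup_seq => -[i _ [C mC <-]].
by rewrite !setTI; have := mf i measurableT C mC; rewrite setTI.
Qed.

Definition cons_row (R : Type) n (p : R * 'rV[R]_n) : 'rV[R]_n.+1 :=
  \row_i oapp (fun j => p.2 0 j) p.1 (unlift ord0 i).

Definition uncons_row (R : Type) n (x : 'rV[R]_n.+1) : R * 'rV[R]_n :=
  (x 0 ord0, \row_j x 0 (lift ord0 j)).

Lemma cons_rowK (R : Type) n : cancel (@cons_row R n) (@uncons_row R n).
Proof.
move=> [a x]; rewrite /uncons_row /cons_row mxE unlift_none /=; congr pair.
by apply/rowP => j; rewrite !mxE liftK.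
Qed.

Lemma uncons_rowK (R : Type) n : cancel (@uncons_row R n) (@cons_row R n).
Proof.
by move=> x; apply/rowP => i; rewrite mxE; case: unliftP => [j|] -> /=;
  rewrite ?mxE.
Qed.

Lemma measurable_cons_row d (T : measurableType d) n :
  measurable_fun [set: T * 'rV[T]_n] (@cons_row T n).
Proof.
apply: measurable_fun_coordP => i.
under eq_fun do rewrite mxE.
case: (unliftP ord0 i) => [j|] _ /=; last exact: measurable_fst.
exact: (measurableT_comp (measurable_coord j) measurable_snd).
Qed.

Lemma measurable_uncons_row d (T : measurableType d) n :
  measurable_fun [set: 'rV[T]_n.+1] (@uncons_row T n).
Proof.
apply: measurable_fun_pair; first exact: measurable_coord.
apply: measurable_fun_coordP => i; under eq_fun do rewrite mxE.
exact: measurable_coord.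
Qed.

(* Lebesgue measure on R^n, as the image of the product of the Lebesgue
   measures on R and R^(n-1). *)
Fixpoint lebN (R : realType) n : set 'rV[R]_n -> \bar R :=
  match n with
  | 0 => dirac (0 : 'rV[R]_0)
  | n'.+1 => pushforward (lebesgue_measure \x @lebN R n')%E (@cons_row R n')
  end.
Arguments lebN {R} n _.

Section lebN_step.
Local Open Scope ereal_scope.
Context {R : realType} (n : nat).
Variable m : {sigma_finite_measure set 'rV[R]_n -> \bar R}.

Let p := pushforward (lebesgue_measure \x m) (@cons_row R n).

Let p0 : p set0 = 0.
Proof. by rewrite /p /pushforward preimage_set0 measure0. Qed.

Let p_ge0 (A : set ('rV[R]_n.+1)) : 0 <= p A.
Proof. by rewrite /p /pushforward. Qed.

Let mpre (A : set 'rV[R]_n.+1) : measurable A ->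
  measurable (@cons_row R n @^-1` A).
Proof.
by move=> mA; rewrite -[X in measurable X]setTI; exact: measurable_cons_row.
Qed.

Let p_sigma_additive : semi_sigma_additive p.
Proof.
move=> F mF tF mUF; rewrite /p /pushforward preimage_bigcup.
apply: measure_semi_sigma_additive.
- by move=> k; exact: mpre.
- apply/trivIsetP => /= i j _ _ ij; rewrite -preimage_setI.
  by move/trivIsetP : tF => /(_ _ _ _ _ ij) ->//; rewrite preimage_set0.
- by rewrite -preimage_bigcup; exact: mpre.
Qed.

HB.instance Definition _ := isMeasure.Build _ _ _ p p0 p_ge0 p_sigma_additive.

Let p_sigma_finite : sigma_finite setT p.
Proof.
have /sigma_finiteP[F [TF ndF Foo]] := sigma_finiteT (@lebesgue_measure R).
have /sigma_finiteP[G [TG ndG Goo]] := sigma_finiteT m.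
exists (fun k => @uncons_row R n @^-1` (F k `*` G k)).
  rewrite -preimage_bigcup (_ : \bigcup_k _ = setT) ?preimage_setT//.
  rewrite -subTset => -[x y] _.
  have [k _ Fkx] : (\bigcup_k F k) x by rewrite -TF.
  have [l _ Gly] : (\bigcup_k G k) y by rewrite -TG.
  exists (maxn k l) => //; split => /=.
  - by move: x Fkx; exact/subsetPset/ndF/leq_maxl.
  - by move: y Gly; exact/subsetPset/ndG/leq_maxr.
move=> k; have [mF Fk] := Foo k; have [mG Gk] := Goo k; split.
  rewrite -[X in measurable X]setTI; apply: measurable_uncons_row => //.
  exact: measurableX.
rewrite /p /pushforward -comp_preimage.
rewrite (_ : _ \o _ = id); last by apply/funext => x /=; rewrite cons_rowK.
rewrite preimage_id product_measure1E//.
by rewrite lte_mul_pinfty// ge0_fin_numE.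
Qed.

HB.instance Definition _ := Measure_isSigmaFinite.Build _ _ _ p p_sigma_finite.

Lemma lebN_step : exists m' : {sigma_finite_measure set 'rV[R]_n.+1 -> \bar R},
  forall A, m' A = p A.
Proof. by exists p. Qed.

End lebN_step.

Section lebN_measure.
Local Open Scope ereal_scope.
Context {R : realType}.

Lemma lebN_sigma_finite_measure n :
  exists m : {sigma_finite_measure set 'rV[R]_n -> \bar R},
    forall A, m A = lebN n A.
Proof.
elim: n => [|n [m mE]]; first by exists (dirac (0%R : 'rV[R]_0)).
have [m' m'E] := lebN_step m; exists m' => A; rewrite m'E /=.
by congr (pushforward (_ \x _) _ _); apply/funext => B; rewrite mE.
Qed.

Variable n : nat.

Let leb0 : lebN n set0 = 0 :> \bar R.
Proof. by have [m mE] := lebN_sigma_finite_measure n; rewrite -mE measure0. Qed.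

Let leb_ge0 (A : set 'rV[R]_n) : 0 <= lebN n A.
Proof. by have [m mE] := lebN_sigma_finite_measure n; rewrite -mE. Qed.

Let leb_sigma_additive : semi_sigma_additive (@lebN R n).
Proof.
have [m /funext mE] := lebN_sigma_finite_measure n; rewrite -mE.
exact: measure_semi_sigma_additive.
Qed.

HB.instance Definition _ := isMeasure.Build _ _ _ (@lebN R n)
  leb0 leb_ge0 leb_sigma_additive.

Let leb_sigma_finite : sigma_finite setT (@lebN R n).
Proof.
have [m /funext mE] := lebN_sigma_finite_measure n; rewrite -mE.
exact: sigma_finiteT.
Qed.

HB.instance Definition _ := Measure_isSigmaFinite.Build _ _ _ (@lebN R n)
  leb_sigma_finite.

End lebN_measure.

Lemma lebN_box (R : realType) n (A : 'I_n -> set R) :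
  (forall i, measurable (A i)) ->
  lebN n [set x | forall i, A i (x 0 i)] =
  (\prod_(i < n) lebesgue_measure (A i))%E.
Proof.
elim: n A => [|n IH] A mA.
  rewrite big_ord0 /= diracE mem_set// => i; by case: i.
have mB : measurable [set x : 'rV[R]_n | forall i, A (lift ord0 i) (x 0 i)].
  rewrite (_ : [set x | _] = \big[setI/setT]_(i < n)
      ((fun x : 'rV[R]_n => x 0 i) @^-1` A (lift ord0 i))).
    apply: bigsetI_measurable => i _; rewrite -[X in measurable X]setTI.
    exact: measurable_coord.
  apply/seteqP; split => x; rewrite -bigcap_seq => Ax i.
    by move=> _; exact: Ax.
  by apply: (Ax i); rewrite /= mem_index_enum.
rewrite big_ord_recl -(IH (fun i => A (lift ord0 i)))// -product_measure1E//.
rewrite -[LHS]/((lebesgue_measure \x lebN n)%E (@cons_row R n @^-1` _)).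
congr (_ \x _)%E; apply/seteqP; split => [[a x] /= Ax|[a x] /= [Aa Ax] i].
- split; first by have := Ax ord0; rewrite mxE unlift_none.
  by move=> i; have := Ax (lift ord0 i); rewrite mxE liftK.
- by rewrite mxE; case: unliftP => [j|] ->/=.
- exact: mA.
Qed.

Section geometry.
Context {R : realType}.

(* The library norm on 'rV[R]_n is the sup norm. *)
Definition sqnorm n (x : 'rV[R]_n) : R := \sum_(i < n) x 0 i ^+ 2.

(* x = (x', x_N) in dimension N = n.+1. *)
Definition tangential n (x : 'rV[R]_n.+1) : 'rV[R]_n := col' ord_max x.
Definition vertical n (x : 'rV[R]_n.+1) : R := x 0 ord_max.

Definition paraboloid n (gamma : R) : set 'rV[R]_n.+1 :=
  [set x | gamma * sqnorm (tangential x) < vertical x].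

Definition rotation n (Q : 'M[R]_n) : Prop := Q *m Q^T = 1%:M /\ \det Q = 1.

Definition frontier (T : topologicalType) (A : set T) : set T :=
  closure A `\` A°.

Definition partial n (i : 'I_n) (f : 'rV[R]_n -> R) (x : 'rV[R]_n) : R :=
  'D_(delta_mx 0 i) (f : 'rV[R]_n -> R^o) x.

(* Meant for open U. *)
Fixpoint Ck k n (U : set 'rV[R]_n) (f : 'rV[R]_n -> R) : Prop :=
  (forall x, U x -> {for x, continuous f}) /\
  match k with
  | 0 => True
  | k'.+1 => forall i : 'I_n,
      (forall x, U x -> derivable (f : 'rV[R]_n -> R^o) x (delta_mx 0 i)) /\
      Ck k' U (partial i f)
  end.

Definition smooth_on n (U : set 'rV[R]_n) (f : 'rV[R]_n -> R) : Prop :=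
  forall k, Ck k U f.

(* In the coordinates y = (x - p) Q centred at p, Omega is near p the set
   { y_N > h(y') }, so that its boundary is the graph of h. *)
Definition epigraph_near n (Omega : set 'rV[R]_n.+1) (p : 'rV[R]_n.+1)
    (Q : 'M[R]_n.+1) (h : 'rV[R]_n -> R) : Prop :=
  \forall x \near p, let y := (x - p) *m Q in
    Omega x <-> h (tangential y) < vertical y.

Definition domain n (Omega : set 'rV[R]_n) : Prop :=
  [/\ open Omega, connected Omega & Omega !=set0].

Definition lipschitz_boundary n (Omega : set 'rV[R]_n.+1) : Prop :=
  forall p, frontier Omega p ->
  exists (Q : 'M[R]_n.+1) (h : 'rV[R]_n -> R),
    [/\ rotation Q, lipschitz (h : 'rV[R]_n -> R^o) &
        epigraph_near Omega p Q h].

(* The last conjunct is h(y') = \sum_i alpha_i y_i^2 + o(|y'|^2). *)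
Definition smooth_boundary_at0 n (Omega : set 'rV[R]_n.+1) : Prop :=
  exists (Q : 'M[R]_n.+1) (h : 'rV[R]_n -> R) (U : set 'rV[R]_n)
      (alpha : 'I_n -> R),
    [/\ rotation Q, epigraph_near Omega 0 Q h,
        open_nbhs (0 : 'rV[R]_n) U /\ smooth_on U h &
        forall e : R, 0 < e -> \forall y \near (0 : 'rV[R]_n),
          `|h y - \sum_(i < n) alpha i * y 0 i ^+ 2| <= e * sqnorm y].

Definition hyperbolic_domain n (Omega : set 'rV[R]_n.+1) : Prop :=
  [/\ domain Omega, lipschitz_boundary Omega,
      frontier Omega 0 /\ smooth_boundary_at0 Omega &
      exists2 gamma, gamma < 0 & Omega `<=` paraboloid gamma].

End geometry.

Section sobolev.
Context {R : realType} {n : nat}.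
Implicit Types (Omega : set 'rV[R]_n) (v : 'rV[R]_n -> R)
  (g : 'rV[R]_n -> 'rV[R]_n).

Definition test_function Omega v : Prop :=
  [/\ smooth_on setT v, compact (closure [set x | v x != 0]) &
      closure [set x | v x != 0] `<=` Omega].

Definition L2 Omega v : Prop :=
  measurable_fun Omega v /\
  (\int[lebN n]_(x in Omega) (v x ^+ 2)%:E < +oo)%E.

Definition weak_gradient Omega v g : Prop :=
  forall (i : 'I_n) (phi : 'rV[R]_n -> R), test_function Omega phi ->
  (\int[lebN n]_(x in Omega) (v x * partial i phi x)%:E =
   - \int[lebN n]_(x in Omega) (g x 0 i * phi x)%:E)%E.

(* v is in H^1(Omega) with weak gradient g. *)
Definition H1 Omega v g : Prop :=
  [/\ L2 Omega v, forall i, L2 Omega (fun x => g x 0 i) &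
      weak_gradient Omega v g].

Definition gradient v (x : 'rV[R]_n) : 'rV[R]_n := \row_i partial i v x.

Definition H1_sqnorm Omega v g : \bar R :=
  (\int[lebN n]_(x in Omega) (v x ^+ 2)%:E +
   \int[lebN n]_(x in Omega) (sqnorm (g x))%:E)%E.

(* v is in H^1_0(Omega), the closure of the test functions in H^1(Omega). *)
Definition H10 Omega v g : Prop :=
  H1 Omega v g /\
  forall e : R, 0 < e -> exists2 phi, test_function Omega phi &
    (H1_sqnorm Omega (fun x => (phi x - v x)%R)
                     (fun x => (gradient phi x - g x)%R) < e%:E)%E.

(* Omega is meant not to contain 0, so that |x|^2 does not vanish on it. *)
Definition hardy_inequality Omega (C K : R) : Prop :=
  forall v g, H10 Omega v g ->
  (K%:E * \int[lebN n]_(x in Omega) (v x ^+ 2 / sqnorm x)%:E <=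
   C%:E * \int[lebN n]_(x in Omega) (v x ^+ 2)%:E +
   \int[lebN n]_(x in Omega) (sqnorm (g x))%:E)%E.

End sobolev.

(* Main.v *)
Require Import Defs.
From mathcomp Require Import all_boot all_order all_algebra.
From mathcomp Require Import all_classical all_reals all_analysis.
From mathcomp Require Import measurable_realfun ring lra.
Import Order.TTheory GRing.Theory Num.Theory.
Import numFieldNormedType.Exports.

Set Implicit Arguments.
Unset Strict Implicit.
Unset Printing Implicit Defensive.

Local Open Scope classical_set_scope.
Local Open Scope ring_scope.

(** The Hardy inequality. Let phi > 0 satisfy - Delta phi >= (K / |x|^2) phi. For
    a test function v, expanding |grad v - v grad phi / phi|^2 >= 0 and
    integrating the divergence of v^2 grad phi / phi gives
    K int v^2/|x|^2 <= int |grad v|^2. In the half-space phi = |x|^(-N/2) x_N does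
    this with K = N^2/4. Above the paraboloid x_N = gamma |x'|^2 one takes
    instead phi = |x|^(-N/2) P with P = x_N + c |x|^2 - d x_N^2, c = - 2 gamma and
    d = c N / 2 ([comparison]): near the origin P is positive, the term in c
    dominating the curvature of the boundary, and phi is a supersolution for
    K = N^2/4 - eps on a ball whose radius depends on eps
    ([comparison_superharmonic]). The field grad phi / phi is cut off outside
    that ball ([log_gradient], [flux]); the cutoff produces only bounded terms
    ([cutoff_combination]), because x . grad phi / phi is bounded below
    ([comparison_radial]), and these are absorbed by the L^2 norm
    ([hardy_test_Rintegral]). The inequality passes to the closure of the test
    functions by a truncation of the weight ([hardy_by_density]).

    Optimality. On the paraboloid above x_N = - 5 |x'|^2 there is a compactly
    supported smooth v >= 0 with - v Delta v <= K' v^2 / |x|^2 and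
    K' < N^2/4 ([profile], [rayleigh]). It has the form
    |x|^(-(N-2)/2) psi(log |x|^2) u(x_N / |x|), where u is supported in a cap
    larger than the half-sphere and is a subsolution with constant
    9/10 (N - 1) instead of N - 1 ([angular_subsolution]), while psi is a bump
    on a long interval (0, L), which costs at most 256 / L^2
    ([radial_subsolution]). Integration by parts bounds the Rayleigh quotient
    of v by K' ([profile_rayleigh]), so that the inequality without the L^2 norm
    fails for all constants between K' and N^2/4. For K' to be below N^2/4 when
    N = 2 already, L = 100 is large enough.

    Both parts rest on the divergence theorem for compactly supported C^1
    fields ([Rintegral_divergence_eq0]), obtained from Fubini's theorem. *)

(** * Integration on R^n *)

Section integration.
Context {R : realType}.

Lemma coord_le_norm n (x : 'rV[R]_n) i : `|x 0 i| <= `|x|.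
Proof.
rewrite [leRHS]mx_normrE.
by apply: (@le_bigmax _ _ _ 0 (fun ij : 'I_1 * 'I_n => `|x ij.1 ij.2|) (0, i)).
Qed.

Lemma norm_le_coord n (x : 'rV[R]_n) M : 0 <= M ->
  (forall i, `|x 0 i| <= M) -> `|x| <= M.
Proof.
move=> M0 xM; rewrite [leLHS]mx_normrE; apply/bigmax_leP; split => // -[i j] _ /=.
by rewrite ord1.
Qed.

Lemma continuous_coord n (i : 'I_n) : continuous (fun x : 'rV[R]_n => x 0 i).
Proof. exact: coord_continuous. Qed.

Lemma measurable_box n (A : 'I_n -> set R) : (forall i, measurable (A i)) ->
  measurable [set x : 'rV[R]_n | forall i, A i (x 0 i)].
Proof.
move=> mA; rewrite (_ : [set x | _] = \big[setI/setT]_(i < n)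
    ((fun x : 'rV[R]_n => x 0 i) @^-1` A i)).
  apply: bigsetI_measurable => i _; rewrite -[X in measurable X]setTI.
  exact: measurable_coord.
apply/seteqP; split => x; rewrite -bigcap_seq => Ax i.
  by move=> _; exact: Ax.
by apply: (Ax i); rewrite /= mem_index_enum.
Qed.

(** The sigma-algebra is generated by the coordinates, the topology by the
    sup norm: an open set is the union of the countably many boxes with
    rational centre and radius 1/(k+1) that it contains. *)
Lemma open_measurable_rV n (A : set 'rV[R]_n) : open A -> measurable A.
Proof.
move=> oA.
pose box (p : 'rV[rat]_n * nat) : set 'rV[R]_n :=
  [set x | forall i, `|x 0 i - ratr (p.1 0 i)| < p.2.+1%:R^-1].
have mbox p : measurable (box p).
  apply: measurable_box (fun i => [set t | `|t - ratr (p.1 0 i)| < p.2.+1%:R^-1]) _ => i.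
  apply: open_measurable.
  rewrite (_ : [set _ | _] = ball (ratr (p.1 0 i) : R) p.2.+1%:R^-1).
    exact: ball_open.
  by apply/seteqP; split => t; rewrite /ball /= distrC.
have -> : A = \bigcup_(p in [set p | box p `<=` A]) box p.
  apply/seteqP; split => [x Ax|x [p pA]]; last exact: pA.
  have /nbhs_ballP[e /= e0 xe] : nbhs x A by exact: open_nbhs_nbhs.
  have [k ke] : exists k : nat, k.+1%:R^-1 < e / 2.
    exists (Num.trunc (e / 2)^-1).
    by rewrite invf_plt ?posrE ?divr_gt0 ?truncnS_gt.
  have /choice[c cP] (i : 'I_n) : exists c : rat, `|x 0 i - ratr c| < k.+1%:R^-1.
    have := @rat_in_itvoo R (x 0 i - k.+1%:R^-1) (x 0 i + k.+1%:R^-1).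
    rewrite ltrD2l gtrN ?invr_gt0 ?ltr0n// => /(_ isT)[c /[!in_itv]/= /andP[c1 c2]].
    by exists c; rewrite ltr_distlC c1 c2.
  exists (\row_i c i, k) => /=; last first.
    by move=> i /=; rewrite mxE.
  move=> y yc; apply: xe; rewrite /ball /=; split => // j i; rewrite ord1.
  have h1 := yc i; have h2 := cP i; rewrite /= mxE in h1.
  apply: (le_lt_trans (ler_distD (ratr (c i)) _ _)).
  rewrite [X in _ + X]distrC (splitr e).
  by apply: ltrD; [exact: lt_trans h2 ke|exact: lt_trans h1 ke].
rewrite bigcup_mkcond; apply: countable_bigcupT_measurable => [|p].
  exact: countableP.
by case: ifP.
Qed.

Lemma continuous_measurable_fun_rV n (f : 'rV[R]_n -> R) (D : set 'rV[R]_n) :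
  measurable D -> continuous f -> measurable_fun D f.
Proof.
move=> mD /continuousP cf; apply: (measurability _ (RGenOpens.measurableE R)).
move=> _ [_ [a [b ->] <-]]; apply: measurableI => //.
by apply: open_measurable_rV; apply: cf; apply: interval_open.
Qed.

Definition bounded_support n (f : 'rV[R]_n -> R) :=
  exists M, forall x, M < `|x| -> f x = 0.

Lemma bounded_support_le n (f : 'rV[R]_n -> R) : continuous f ->
  bounded_support f -> exists B, forall x, `|f x| <= B.
Proof.
move=> cf [M fM].
have cK : compact [set x : 'rV[R]_n | `|x| <= M].
  apply: bounded_closed_compact.
    by exists M; split; [exact: num_real|move=> y My x xM; exact: le_trans xM (ltW My)].
  rewrite (_ : [set _ | _] = (fun x : 'rV[R]_n => `|x|) @^-1` [set t | t <= M])//.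
  by apply: closed_comp => [x _|]; [exact: norm_continuous|exact: closed_le].
have [B [_ BP]] : bounded_set (f @` [set x | `|x| <= M]).
  by apply/compact_bounded/continuous_compact => //; exact: continuous_subspaceT.
exists (`|B| + 1) => x; have [xM|/fM->] := leP `|x| M; last first.
  by rewrite normr0 addr_ge0.
apply: (BP (`|B| + 1)); last by exists x.
by rewrite (le_lt_trans (ler_norm B))// ltrDl.
Qed.

Lemma bounded_support_integrable n (f : 'rV[R]_n -> R) : continuous f ->
  bounded_support f -> (@lebN R n).-integrable setT (EFin \o f).
Proof.
move=> cf sf; have [B fB] := bounded_support_le cf sf; have [M fM] := sf.
pose A : set 'rV[R]_n := [set x | forall i, x 0 i \in `[- M, M]].
have mA : measurable A by exact: (measurable_box (fun=> measurable_itv _)).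
have iA : (@lebN R n).-integrable setT (EFin \o (fun x => B * \1_A x)).
  apply: (@integrableZl _ _ _ _ _ measurableT B (EFin \o \1_A)).
  apply/integrableP; split; first by apply/measurable_EFinP; exact: measurable_indic.
  rewrite (eq_integral (EFin \o \1_A)) => [|x _]; last first.
    by rewrite /= ger0_norm// indicE.
  rewrite integral_indic// setIT.
  suff : (lebN n A < +oo)%E by [].
  have -> : lebN n A = _ := @lebN_box R n (fun=> `[- M, M]%classic) (fun=> measurable_itv _).
  rewrite ltey_eq; apply/orP; left.
  apply: prode_fin_num => i _; rewrite lebesgue_measure_itv/=.
  by case: ifPn.
apply: le_integrable iA => //.
  by apply/measurable_EFinP; exact: continuous_measurable_fun_rV.
move=> x _ /=; rewrite lee_fin; have [Ax|nAx] := pselect (A x).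
  rewrite indicE mem_set// mulr1; exact: le_trans (fB x) (ler_norm _).
suff -> : f x = 0 by rewrite normr0.
apply: fM; rewrite ltNge; apply/negP => xM; apply: nAx => i.
by rewrite in_itv/= -ler_norml (le_trans (coord_le_norm _ _)).
Qed.
End integration.

(** * Integration by parts *)

Section integration_by_parts.
Context {R : realType}.

(** A directional derivative only depends on the restriction to a line. *)
Lemma is_derive_line (V W : normedModType R) (f : V -> R^o) (g : W -> R^o)
    (x v : V) (y w : W) (d : R) :
  (forall h : R, f (h *: v + x) = g (h *: w + y)) ->
  is_derive x v f d -> is_derive y w g d.
Proof.
move=> fg [df <-].
have fxy : f x = g y by have := fg 0; rewrite !scale0r !add0r.
have E : (fun h : R => h^-1 *: (f (h *: v + x) - f x)) =
         (fun h : R => h^-1 *: (g (h *: w + y) - g y)).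
  by apply/funext => h; rewrite fg fxy.
split; first by move: df; rewrite /derivable -[X in X @ _]/(fun h : R => _) E.
by rewrite /derive -[X in X @ _]/(fun h : R => _) -E.
Qed.

Lemma integral_derivative_eq0 (f df : R -> R) (M : R) :
  (forall x : R, is_derive x 1 (f : R -> R^o) (df x)) -> continuous df ->
  (forall x, M < `|x| -> f x = 0) ->
  (forall x, M < `|x| -> df x = 0) ->
  (\int[lebesgue_measure]_x (df x)%:E = 0)%E.
Proof.
move=> fdf cdf fM dfM.
pose b := `|M| + 1.
have b0 : 0 < b by rewrite ltr_wpDl.
have Mb : M < b by rewrite (le_lt_trans (ler_norm M))// ltrDl.
rewrite (_ : (fun x => (df x)%:E) = (EFin \o df) \_ `[-b, b]); last first.
  apply/funext => x; rewrite patchE; case: ifPn => //.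
  rewrite notin_setE /= in_itv/= -ler_norml => /negP.
  by rewrite -ltNge => bx; rewrite dfM// (lt_trans Mb).
rewrite -integral_mkcond.
have cf : continuous f.
  move=> x; apply: differentiable_continuous; apply/derivable1_diffP.
  by have [] := fdf x.
rewrite (@continuous_FTC2 _ df f)//.
- rewrite !fM ?subee// ?normrN ?ger0_norm// ltW//.
- by rewrite -subr_gt0 opprK addr_gt0.
- exact: continuous_subspaceT.
- split=> [x _||].
  + by have [] := fdf x.
  + exact/cvg_at_right_filter/cf.
  + exact/cvg_at_left_filter/cf.
- by move=> x _; rewrite derive1E; have [] := fdf x.
Qed.

Lemma cons_rowD n (a b : R) (x y : 'rV[R]_n) (h : R) :
  cons_row (h * a + b, h *: x + y) = h *: cons_row (a, x) + cons_row (b, y).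
Proof.
by apply/rowP => i; rewrite !mxE; case: unliftP => [j|] _ /=; rewrite ?mxE.
Qed.

Lemma cons_row_delta0 n : cons_row (1, 0) = delta_mx 0 ord0 :> 'rV[R]_n.+1.
Proof.
apply/rowP => i; rewrite !mxE eqxx; case: unliftP => [j ->|->] /=.
  by rewrite mxE.
by [].
Qed.

Lemma cons_row_delta n (j : 'I_n) :
  cons_row (0, delta_mx 0 j) = delta_mx 0 (lift ord0 j) :> 'rV[R]_n.+1.
Proof.
apply/rowP => i; rewrite !mxE eqxx; case: unliftP => [k ->|->] /=.
  by rewrite mxE eqxx /= (inj_eq lift_inj).
by [].
Qed.

Lemma continuous_cons_row_head n (y : 'rV[R]_n) :
  continuous (fun x => cons_row (x, y)).
Proof.
move=> x A /nbhs_ballP[e /= e0 eA]; apply/nbhs_ballP; exists e => //= z xz.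
apply: eA; split => // i j; rewrite !mxE.
by case: unliftP => [k|] _ //=; exact: ballxx.
Qed.

Lemma continuous_cons_row_tail n (x : R) :
  continuous (fun y : 'rV[R]_n => cons_row (x, y)).
Proof.
move=> y A /nbhs_ballP[e /= e0 eA]; apply/nbhs_ballP; exists e => //= z [_ yz].
apply: eA; split => // i j; rewrite !mxE.
by case: unliftP => [k|] _ //=; exact: ballxx.
Qed.

Lemma norm_cons_row_head n (x : R) (y : 'rV[R]_n) : `|x| <= `|cons_row (x, y)|.
Proof.
by have := coord_le_norm (cons_row (x, y)) ord0; rewrite mxE unlift_none.
Qed.

Lemma norm_cons_row_tail n (x : R) (y : 'rV[R]_n) : `|y| <= `|cons_row (x, y)|.
Proof.
apply: norm_le_coord => // i.
by have := coord_le_norm (cons_row (x, y)) (lift ord0 i); rewrite mxE liftK.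
Qed.

Lemma integral_lebNS n (f : 'rV[R]_n.+1 -> R) : continuous f ->
  bounded_support f ->
  (lebesgue_measure \x @lebN R n)%E.-integrable setT
     (fun p => (f (cons_row p))%:E) /\
  (\int[lebN n.+1]_x (f x)%:E =
   \int[(lebesgue_measure \x lebN n)%E]_p (f (cons_row p))%:E)%E.
Proof.
move=> cf sf.
have mf : measurable_fun setT (EFin \o f).
  by apply/measurable_EFinP; exact: continuous_measurable_fun_rV.
have mfc : measurable_fun setT (fun p : R * 'rV[R]_n => (f (cons_row p))%:E).
  exact: (measurableT_comp mf (@measurable_cons_row _ R n)).
have ifc : (lebesgue_measure \x @lebN R n)%E.-integrable setT
     (fun p => (f (cons_row p))%:E).
  apply/integrableP; split => //.
  have /integrableP[_] := bounded_support_integrable cf sf.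
  rewrite -[X in integral X _ _]/(pushforward (lebesgue_measure \x @lebN R n)%E (@cons_row R n)).
  rewrite ge0_integral_pushforward//.
  - exact: measurable_cons_row.
  - exact: measurableT_comp.
split => //.
rewrite -[X in integral X _ _]/(pushforward (lebesgue_measure \x @lebN R n)%E (@cons_row R n)).
by rewrite integral_pushforward//; exact: measurable_cons_row.
Qed.

(** Fubini's theorem reduces this to dimension one: the integral of lebN in
    dimension n.+1 is a product integral over the first coordinate and the
    remaining ones, and the partial derivative vanishes upon integration in the
    first coordinate if i is the first one, in the others by induction
    otherwise. *)
Lemma integral_partial_eq0 n (i : 'I_n) (f df : 'rV[R]_n -> R) :
  (forall x, is_derive x (delta_mx 0 i) (f : _ -> R^o) (df x)) ->
  bounded_support f -> continuous df -> bounded_support df ->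
  (\int[lebN n]_x (df x)%:E = 0)%E.
Proof.
elim: n i f df => [[]//|n IH i f df fdf [M fM] cdf [M' dfM]].
have [idf ->] := integral_lebNS cdf (ex_intro _ M' dfM).
case: (unliftP ord0 i) => [j|] ij.
  rewrite -(integral12_prod_meas1 idf).
  apply: integral0_eq => x _; rewrite /fubini_F/=.
  apply: (IH j (fun y => f (cons_row (x, y)))).
  - move=> y; have := fdf (cons_row (x, y)); rewrite ij -cons_row_delta.
    apply: is_derive_line => h.
    by rewrite -cons_rowD mulr0 add0r.
  - by exists M => y My; rewrite fM// (lt_le_trans My)// norm_cons_row_tail.
  - move=> y; apply: continuous_comp; [exact: continuous_cons_row_tail|exact: cdf].
  - by exists M' => y My; rewrite dfM// (lt_le_trans My)// norm_cons_row_tail.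
rewrite -(integral21_prod_meas1 idf).
apply: integral0_eq => y _; rewrite /fubini_G/=.
apply: (@integral_derivative_eq0 (fun x => f (cons_row (x, y))) _ (Num.max M M')).
- move=> x; have := fdf (cons_row (x, y)); rewrite ij -cons_row_delta0.
  apply: is_derive_line => h.
  by rewrite -cons_rowD scaler0 add0r.
- move=> x; apply: continuous_comp; [exact: continuous_cons_row_head|exact: cdf].
- move=> x; rewrite gt_max => /andP[Mx _].
  by rewrite fM// (lt_le_trans Mx)// norm_cons_row_head.
- move=> x; rewrite gt_max => /andP[_ Mx].
  by rewrite dfM// (lt_le_trans Mx)// norm_cons_row_head.
Qed.

End integration_by_parts.

(** * Calculus of C^k functions *)

Section chain_rule.
Context {R : realType} {V : normedModType R}.
Implicit Types (f g : V -> R) (x v : V).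

(** Restricting [f] to the line through [x] directed by [v] reduces the claim to
    the chain rule in dimension one. *)
Lemma is_derive_comp (b : R -> R) f x v (db df : R) :
  is_derive (f x) 1 (b : R -> R^o) db -> is_derive x v (f : V -> R^o) df ->
  is_derive x v ((fun y => b (f y)) : V -> R^o) (db * df).
Proof.
move=> bd fd; pose phi (h : R) : R := f (h *: v + x).
have phid : is_derive (0 : R) 1 phi df.
  by apply: is_derive_line fd => h; rewrite /phi addr0 [_%:A]mulr1.
have bd0 : is_derive (phi 0) 1 (b : R -> R^o) db.
  by rewrite /phi scale0r add0r.
have := is_derive1_comp bd0 phid.
by apply: is_derive_line => h; rewrite /phi /= addr0 [_%:A]mulr1.
Qed.

Lemma is_derive_ext f g x v (df dg : R) : (forall y, f y = g y) -> df = dg ->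
  is_derive x v (f : V -> R^o) df -> is_derive x v (g : V -> R^o) dg.
Proof. by move=> /funext -> ->. Qed.

Lemma is_derive_mul f g x v (df dg : R) :
  is_derive x v (f : V -> R^o) df -> is_derive x v (g : V -> R^o) dg ->
  is_derive x v ((fun y => f y * g y) : V -> R^o) (df * g x + f x * dg).
Proof.
move=> fd gd; apply: (is_derive_eq (is_deriveM fd gd)).
by rewrite addrC; congr +%R; rewrite mulrC.
Qed.

Lemma is_derive_add f g x v (df dg : R) :
  is_derive x v (f : V -> R^o) df -> is_derive x v (g : V -> R^o) dg ->
  is_derive x v ((fun y => f y + g y) : V -> R^o) (df + dg).
Proof. by move=> fd gd; exact: is_deriveD. Qed.

Lemma is_derive_scale (c : R) f x v (df : R) :
  is_derive x v (f : V -> R^o) df ->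
  is_derive x v ((fun y => c * f y) : V -> R^o) (c * df).
Proof. by move=> fd; exact: is_deriveZ. Qed.

Lemma is_derive_pow m f x v (df : R) :
  is_derive x v (f : V -> R^o) df ->
  is_derive x v ((fun y => f y ^+ m) : V -> R^o) (m%:R * f x ^+ m.-1 * df).
Proof.
move=> fd; have -> : (fun y => f y ^+ m) = f ^+ m.
  by apply/funext => y; rewrite exprfctE.
exact: is_deriveX.
Qed.

Lemma is_derive_inv f x v (df : R) : f x != 0 ->
  is_derive x v (f : V -> R^o) df ->
  is_derive x v ((fun y => (f y)^-1) : V -> R^o) (- df / f x ^+ 2).
Proof.
move=> fx0 fd.
have iV : is_derive (f x) 1 ((fun t : R => t^-1) : R -> R^o) (- f x ^- 2).
  have := @is_deriveV R id (f x) 1 1 fx0 (is_derive_id _ _).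
  by move/is_derive_eq; apply; rewrite [LHS]mulr1.
by apply: (is_derive_eq (is_derive_comp iV fd)); rewrite mulrC mulrN mulNr.
Qed.

Lemma is_derive_exp f x v (df : R) :
  is_derive x v (f : V -> R^o) df ->
  is_derive x v ((fun y => expR (f y)) : V -> R^o) (expR (f x) * df).
Proof. by move=> fd; exact: (is_derive_comp (is_derive_expR _) fd). Qed.

Lemma is_derive_log f x v (df : R) : 0 < f x ->
  is_derive x v (f : V -> R^o) df ->
  is_derive x v ((fun y => ln (f y)) : V -> R^o) ((f x)^-1 * df).
Proof. by move=> fx fd; exact: (is_derive_comp (is_derive1_ln _) fd). Qed.

End chain_rule.

Section Ck_calculus.
Context {R : realType} {n : nat}.
Implicit Types (U V : set 'rV[R]_n) (f g : 'rV[R]_n -> R).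

Lemma is_derive_coord i j (x : 'rV[R]_n) :
  is_derive x (delta_mx 0 i) ((fun y => y 0 j) : 'rV[R]_n -> R^o) (i == j)%:R.
Proof.
have D : is_derive (0 : R) 1 ((fun h => h * (i == j)%:R + x 0 j) : R -> R^o) (i == j)%:R.
  have := is_derive_add (@is_derive_mul _ _ id (cst (i == j)%:R) 0 1 _ _
    (is_derive_id _ _) (is_derive_cst _ _ _)) (is_derive_cst (x 0 j : R^o) (0 : R) (1 : R)).
  by move/is_derive_eq; apply; rewrite mul1r mulr0 !addr0.
apply: is_derive_line D => h.
by rewrite !mxE addr0 [_%:A]mulr1 eqxx /= eq_sym.
Qed.

Lemma partial_is_derive i f x (d : R) :
  is_derive x (delta_mx 0 i) (f : _ -> R^o) d -> partial i f x = d.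
Proof. by case. Qed.

Lemma Ck_continuous k U f x : Ck k U f -> U x -> {for x, continuous f}.
Proof. by case: k => [|k] [cf _]; exact: cf. Qed.

Lemma Ck_le k m U f : (k <= m)%N -> Ck m U f -> Ck k U f.
Proof.
elim: k m f => [m f _|k IH [//|m] f km] Cf.
  by split => // x; exact: Ck_continuous Cf.
case: Cf => cf df; split => // i; split; first by case: (df i).
by have [_ Ci] := df i; exact: IH Ci.
Qed.

Lemma Ck_sub k U V f : V `<=` U -> Ck k U f -> Ck k V f.
Proof.
move=> VU; elim: k f => [|k IH] f [cf df]; (split=> [x /VU|]; first exact: cf) => // i.
have [dfi Ci] := df i; split; last exact: IH.
by move=> x /VU; exact: dfi.
Qed.

Lemma CkU k U V f : Ck k U f -> Ck k V f -> Ck k (U `|` V) f.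
Proof.
elim: k f => [|k IH] f [cf df] [cf' df'];
  (split=> [x [/cf//|/cf'//]|]) => // i.
have [dfi Ci] := df i; have [dfi' Ci'] := df' i; split; last exact: IH.
by move=> x [/dfi|/dfi'].
Qed.

Lemma near_eq_continuous (T S : topologicalType) (f g : T -> S) (x : T) :
  (\near x, f x = g x) -> {for x, continuous f} -> {for x, continuous g}.
Proof.
move=> fg cf; have fgx : f x = g x by exact: nbhs_singleton fg.
change (g y @[y --> x] --> g x); rewrite -fgx.
by apply: cvg_trans cf; apply: near_eq_cvg.
Qed.

Lemma Ck_eq k U f g : open U -> (forall x, U x -> f x = g x) ->
  Ck k U f -> Ck k U g.
Proof.
move=> oU; elim: k f g => [|k IH] f g fg [cf df].
  split => // x Ux; apply: near_eq_continuous (cf _ Ux).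
  by near=> z; apply: fg; near: z; exact: open_nbhs_nbhs.
have fgn x : U x -> \near x, f x = g x.
  by move=> Ux; near=> z; apply: fg; near: z; exact: open_nbhs_nbhs.
split => [x Ux|i]; first exact: near_eq_continuous (fgn _ Ux) (cf _ Ux).
have [dfi Ci] := df i; split.
  by move=> x Ux; apply: near_eq_derivable (dfi _ Ux); exact: fgn.
apply: IH Ci => x Ux; apply: near_eq_derive; exact: fgn.
Unshelve. all: by end_near. Qed.

(** This is how functions are shown to be of class C^k below, one order at a
    time; formulas for the derivatives that are valid on [U] suffice. *)
Lemma CkS k U f (d : 'I_n -> 'rV[R]_n -> R) : open U ->
  (forall x, U x -> {for x, continuous f}) ->
  (forall i x, U x -> is_derive x (delta_mx 0 i) (f : _ -> R^o) (d i x)) ->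
  (forall i, Ck k U (d i)) -> Ck k.+1 U f.
Proof.
move=> oU cf df Cd; split=> // i; split=> [x Ux|]; first by have [] := df i x Ux.
by apply: Ck_eq (Cd i) => // x Ux; have [] := df i x Ux.
Qed.

Lemma Ck_derive k U f i x : Ck k.+1 U f -> U x ->
  is_derive x (delta_mx 0 i) (f : _ -> R^o) (partial i f x).
Proof. by move=> [_ /(_ i)[df _]] Ux; apply/derivableP/df. Qed.

Lemma Ck_partial k U f i : Ck k.+1 U f -> Ck k U (partial i f).
Proof. by move=> [_ /(_ i)[]]. Qed.

Lemma Ck_cst k U (c : R) : open U -> Ck k U (fun=> c).
Proof.
move=> oU; elim: k c => [|k IH] c; first by split => // x _; exact: cst_continuous.
by apply: (CkS (d := fun _ _ => 0)) => // x _; exact: cst_continuous.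
Qed.

Lemma Ck_coord k U j : open U -> Ck k U (fun x => x 0 j).
Proof.
move=> oU; case: k => [|k]; first by split => // x _; exact: continuous_coord.
apply: (CkS (d := fun i _ => (i == j)%:R)) => // [x _|i x _|i].
- exact: continuous_coord.
- exact: is_derive_coord.
- exact: Ck_cst.
Qed.

Lemma CkD k U f g : open U -> Ck k U f -> Ck k U g ->
  Ck k U (fun x => f x + g x).
Proof.
move=> oU; elim: k f g => [|k IH] f g Cf Cg.
  by split => // x Ux; exact: (cvgD (Ck_continuous Cf Ux) (Ck_continuous Cg Ux)).
apply: (CkS (d := fun i x => partial i f x + partial i g x)) => // [x Ux|i x Ux|i].
- by exact: (cvgD (Ck_continuous Cf Ux) (Ck_continuous Cg Ux)).
- by apply: is_derive_add; [exact: (Ck_derive i Cf Ux)|exact: (Ck_derive i Cg Ux)].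
- by apply: IH; exact: Ck_partial.
Qed.

Lemma CkM k U f g : open U -> Ck k U f -> Ck k U g ->
  Ck k U (fun x => f x * g x).
Proof.
move=> oU; elim: k f g => [|k IH] f g Cf Cg.
  by split => // x Ux; exact: (cvgM (Ck_continuous Cf Ux) (Ck_continuous Cg Ux)).
apply: (CkS (d := fun i x => partial i f x * g x + f x * partial i g x)) => // [x Ux|i x Ux|i].
- by exact: (cvgM (Ck_continuous Cf Ux) (Ck_continuous Cg Ux)).
- by apply: is_derive_mul; [exact: (Ck_derive i Cf Ux)|exact: (Ck_derive i Cg Ux)].
- by apply: CkD => //; apply: IH; try exact: Ck_partial; exact: Ck_le (leqnSn k) _.
Qed.

Lemma CkZ k U (c : R) f : open U -> Ck k U f -> Ck k U (fun x => c * f x).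
Proof. by move=> oU Cf; apply: CkM => //; exact: Ck_cst. Qed.

Lemma Ck_sum k U m (F : 'I_m -> 'rV[R]_n -> R) : open U ->
  (forall j, Ck k U (F j)) -> Ck k U (fun x => \sum_(j < m) F j x).
Proof.
move=> oU; elim: m F => [|m IH] F CF.
  by under eq_fun do rewrite big_ord0; exact: Ck_cst.
under eq_fun do rewrite big_ord_recl.
by apply: CkD => //; apply: IH.
Qed.

Lemma CkV k U f : open U -> (forall x, U x -> f x != 0) ->
  Ck k U f -> Ck k U (fun x => (f x)^-1).
Proof.
move=> oU f0; elim: k => [|k IH] Cf.
  by split => // x Ux; exact: (cvgV (f0 _ Ux) (Ck_continuous Cf Ux)).
have CV : Ck k U (fun x => (f x)^-1) by apply: IH; exact: Ck_le (leqnSn k) _.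
apply: (CkS (d := fun i x => - 1 * (partial i f x * ((f x)^-1 * (f x)^-1)))) => // [x Ux|i x Ux|i].
- by exact: (cvgV (f0 _ Ux) (Ck_continuous Cf Ux)).
- apply: (is_derive_eq (is_derive_inv (f0 _ Ux) (Ck_derive i Cf Ux))).
  by rewrite !mulNr mul1r expr2 invfM.
- apply: CkZ => //; apply: CkM => //; first exact: Ck_partial.
  exact: CkM.
Qed.

Lemma Ck_exp k U f : open U -> Ck k U f -> Ck k U (fun x => expR (f x)).
Proof.
move=> oU; elim: k => [|k IH] Cf.
  split => // x Ux; apply: (@continuous_comp _ _ _ f expR); last exact: continuous_expR.
  exact: (Ck_continuous Cf Ux).
apply: (CkS (d := fun i x => expR (f x) * partial i f x)) => // [x Ux|i x Ux|i].
- apply: (@continuous_comp _ _ _ f expR); last exact: continuous_expR.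
  exact: (Ck_continuous Cf Ux).
- exact: is_derive_exp (Ck_derive i Cf Ux).
- by apply: CkM => //; [apply: IH; exact: Ck_le (leqnSn k) _|exact: Ck_partial].
Qed.

Lemma Ck_log k U f : open U -> (forall x, U x -> 0 < f x) ->
  Ck k U f -> Ck k U (fun x => ln (f x)).
Proof.
move=> oU f0 Cf.
have cl x : U x -> {for x, continuous (fun x => ln (f x))}.
  by move=> Ux; exact: (continuous_comp (Ck_continuous Cf Ux) (continuous_ln (f0 _ Ux))).
case: k Cf => [|k] Cf; first by split => // x Ux.
apply: (CkS (d := fun i x => (f x)^-1 * partial i f x)) => // [i x Ux|i].
- exact: is_derive_log (f0 _ Ux) (Ck_derive i Cf Ux).
- apply: CkM => //; last exact: Ck_partial.
  by apply: CkV (Ck_le (leqnSn k) _) => // x /f0/lt0r_neq0.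
Qed.

End Ck_calculus.

(** * One-dimensional cutoff functions *)

Section flat.
Context {R : realType}.

(** The family indexed by [m] is stable under differentiation up to linear
    combinations, so that smoothness of exp(-1/t) follows by induction for all
    its members at once. *)
Definition flat (m : nat) (t : R) : R :=
  if 0 < t then t^-1 ^+ m * expR (- t^-1) else 0.

Lemma flatE m t : 0 < t -> flat m t = t^-1 ^+ m * expR (- t^-1).
Proof. by rewrite /flat => ->. Qed.

Lemma flat_le0 m t : t <= 0 -> flat m t = 0.
Proof. by rewrite /flat ltNge => ->. Qed.

Lemma flat_ge0 m t : 0 <= flat m t.
Proof.
rewrite /flat; case: ifP => // t0; apply: mulr_ge0; last exact: expR_ge0.
by rewrite exprn_ge0// invr_ge0 ltW.
Qed.

Lemma flatS m t : t^-1 * flat m t = flat m.+1 t.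
Proof. by rewrite /flat; case: ifP => _; rewrite ?mulr0// exprS mulrA. Qed.

(** This is exp(1/t) >= (1/t)^(m+1) / (m+1)!. *)
Lemma flat_bound m t : flat m t <= m.+1`!%:R * `|t|.
Proof.
have [t0|t0] := ltP 0 t; last by rewrite flat_le0// mulr_ge0.
rewrite flatE// expRN gtr0_norm// ler_pdivrMr ?expR_gt0//.
have it0 : 0 < t^-1 by rewrite invr_gt0.
have f0 : 0 < (m.+1`!%:R : R) by rewrite ltr0n fact_gt0.
have := @expR_ge1Dxn _ t^-1 m (ltW it0); set e := expR _ => he.
have : t^-1 ^+ m.+1 / m.+1`!%:R <= e by apply: le_trans he; rewrite lerDr.
rewrite ler_pdivrMr// => h.
have -> : t^-1 ^+ m = t * t^-1 ^+ m.+1 by rewrite exprS mulVKf ?gt_eqF.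
by rewrite [X in X * e]mulrC -mulrA ler_pM2l// [X in _ <= X]mulrC.
Qed.

Lemma flat_cvg0 m : flat m t @[t --> (0 : R)] --> (0 : R).
Proof.
apply: (@squeeze_cvgr _ _ _ _ (fun=> 0) (fun t : R => m.+1`!%:R * `|t|)).
- by near=> t; rewrite flat_ge0 flat_bound.
- exact: cvg_cst.
- rewrite -[X in _ --> X](mulr0 m.+1`!%:R) -[X in _ * X](normr0 R).
  by apply: cvgM; [exact: cvg_cst|exact: cvg_norm].
Unshelve. all: by end_near. Qed.

(** The difference quotient of [flat m] at 0 is [flat m.+1], which tends to 0. *)
Lemma is_derive_flat m (t : R) :
  is_derive t 1 (flat m : R -> R^o) (flat m.+2 t - m%:R * flat m.+1 t).
Proof.
have [t0|t0|t0] := ltgtP t 0.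
- rewrite !flat_le0 ?ltW// mulr0 subrr.
  apply: (near_eq_is_derive (f := cst 0)).
  near=> z; rewrite flat_le0// ltW//; near: z.
  exact: lt_nbhsl.
- apply: (@near_eq_is_derive _ R R^o (fun t => t^-1 ^+ m * expR (- t^-1))).
    near=> z; rewrite flatE//; near: z.
    exact: lt_nbhsr.
  have dV := is_derive_inv (lt0r_neq0 t0) (is_derive_id t (1 : R)).
  have dN : is_derive t 1 ((fun y => - y^-1) : R -> R^o) _ := is_deriveN dV.
  have dE := is_derive_exp dN.
  have dX := is_derive_pow m dV.
  apply: (is_derive_eq (is_derive_mul dX dE)).
  rewrite !flatE// -!exprVn.
  case: m {dX} => [|m]; rewrite /= ?expr0 ?exprS; field; rewrite gt_eqF//.
- rewrite t0 !flat_le0// mulr0 subr0.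
  have E : (fun h : R => h^-1 *: (flat m (h *: 1 + 0) - flat m 0)) = flat m.+1.
    apply/funext => h; rewrite (flat_le0 m (lexx 0)) subr0 addr0 [_%:A]mulr1.
    exact: flatS.
  have D : h^-1 *: (flat m (h *: 1 + 0) - flat m 0) @[h --> 0^'] --> (0 : R^o).
    rewrite E; apply: (cvg_trans _ (@flat_cvg0 m.+1)).
    by apply: cvg_app; exact: cvg_within.
  split; first by apply/cvg_ex; exists 0.
  exact/cvg_lim.
Unshelve. all: by end_near. Qed.

Lemma continuous_flat m : continuous (flat m).
Proof.
move=> t; apply: (@differentiable_continuous _ _ _ t (flat m)).
by apply/derivable1_diffP; have [] := is_derive_flat m t.
Qed.

Lemma Ck_flat n k m (U : set 'rV[R]_n) (f : 'rV[R]_n -> R) : open U ->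
  Ck k U f -> Ck k U (fun x => flat m (f x)).
Proof.
move=> oU; elim: k m => [|k IH] m Cf.
  split => // x Ux.
  exact: (continuous_comp (Ck_continuous Cf Ux) (@continuous_flat m (f x))).
apply: (CkS (d := fun i x => (flat m.+2 (f x) + - m%:R * flat m.+1 (f x)) *
    partial i f x)) => // [x Ux|i x Ux|i].
- exact: (continuous_comp (Ck_continuous Cf Ux) (@continuous_flat m (f x))).
- have := is_derive_comp (is_derive_flat m (f x)) (Ck_derive i Cf Ux).
  by rewrite mulNr.
- have Cf' := Ck_le (leqnSn k) Cf.
  apply: CkM => //; last exact: Ck_partial.
  by apply: CkD => //; [exact: IH|apply: CkZ => //; exact: IH].
Qed.

(** A cutoff of class C^1 only, but with a simple derivative. *)
Definition sqpos (t : R) := Num.max 0 t ^+ 2.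

Lemma continuous_maxr0 : continuous (fun t : R => Num.max 0 t : R).
Proof. by move=> t; apply: continuous_max; [exact: cvg_cst|exact: cvg_id]. Qed.

Lemma is_derive_sqpos (t : R) :
  is_derive t 1 (sqpos : R -> R^o) (2 * Num.max 0 t).
Proof.
have [t0|t0|t0] := ltgtP t 0.
- rewrite mulr0.
  apply: (near_eq_is_derive (f := cst 0)).
  near=> z; rewrite /sqpos max_l ?expr0n// ltW//; near: z.
  exact: lt_nbhsl.
- apply: (@near_eq_is_derive _ R R^o (fun t => t ^+ 2)).
    near=> z; rewrite /sqpos max_r// ltW//; near: z.
    exact: lt_nbhsr.
  apply: (is_derive_eq (is_derive_pow 2 (is_derive_id t (1 : R)))).
  by rewrite /= expr1 mulr1.
- rewrite t0 mulr0.
  have E : (fun h : R => h^-1 *: (sqpos (h *: 1 + 0) - sqpos 0)) =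
      (fun h : R => Num.max 0 h).
    apply/funext => h; rewrite /sqpos maxxx expr0n subr0 addr0 [_%:A]mulr1.
    rewrite -[_ *: _]/(_ * _); have [h0|h0] := leP h 0; first by rewrite expr0n mulr0.
    by rewrite expr2 mulKf ?gt_eqF.
  have D : h^-1 *: (sqpos (h *: 1 + 0) - sqpos 0) @[h --> 0^'] --> (0 : R^o).
    have := @continuous_maxr0 0; rewrite /continuous_at maxxx => c0.
    by rewrite E; apply: (cvg_trans _ c0); apply: cvg_app; exact: cvg_within.
  split; first by apply/cvg_ex; exists 0.
  exact/cvg_lim.
Unshelve. all: by end_near. Qed.

Lemma continuous_sqpos : continuous sqpos.
Proof.
move=> t; apply: (@differentiable_continuous _ _ _ t sqpos).
by apply/derivable1_diffP; have [] := is_derive_sqpos t.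
Qed.

Lemma C1_sqpos n (U : set 'rV[R]_n) (f : 'rV[R]_n -> R) : open U ->
  Ck 1 U f -> Ck 1 U (fun x => sqpos (f x)).
Proof.
move=> oU Cf.
have Cm : Ck 0 U (fun x => Num.max 0 (f x)).
  split => // x Ux.
  exact: (continuous_comp (Ck_continuous Cf Ux) (@continuous_maxr0 (f x))).
apply: (CkS (d := fun i x => (2 * Num.max 0 (f x)) * partial i f x)) => // [x Ux|i x Ux|i].
- exact: (continuous_comp (Ck_continuous Cf Ux) (@continuous_sqpos (f x))).
- exact: is_derive_comp (is_derive_sqpos (f x)) (Ck_derive i Cf Ux).
- by apply: CkM => //; [exact: CkZ|exact: Ck_partial].
Qed.
End flat.

(** * Coordinates and the comparison function *)

Section coordinates.
Context {R : realType} {n : nat}.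
Implicit Types x : 'rV[R]_n.+1.

Lemma is_derive_bigsum (V : normedModType R) m (F : 'I_m -> V -> R) (x v : V)
    (d : 'I_m -> R) :
  (forall j, is_derive x v (F j : V -> R^o) (d j)) ->
  is_derive x v ((fun y => \sum_(j < m) F j y) : V -> R^o) (\sum_(j < m) d j).
Proof.
move=> Fd; have -> : (fun y => \sum_(j < m) F j y) = \sum_(j < m) (F j : V -> R^o).
  by apply/funext => y; rewrite fct_sumE.
exact: is_derive_sum.
Qed.

Lemma is_derive_sqnorm m i (x : 'rV[R]_m) :
  is_derive x (delta_mx 0 i) (@sqnorm R m : _ -> R^o) (2 * x 0 i).
Proof.
have := is_derive_bigsum (fun j => is_derive_pow 2 (is_derive_coord i j x)).
move/is_derive_eq; apply; rewrite (bigD1 i)//= eqxx mulr1 expr1 big1 ?addr0// => j ji.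
by rewrite eq_sym (negbTE ji) mulr0.
Qed.

Lemma Ck_sqnorm m k (U : set 'rV[R]_m) : open U -> Ck k U (@sqnorm R m).
Proof.
move=> oU; apply: Ck_sum => // j.
under eq_fun do rewrite expr2.
by apply: CkM => //; exact: Ck_coord.
Qed.

Lemma continuous_sqnorm m : continuous (@sqnorm R m).
Proof. by move=> x; exact: (Ck_continuous (Ck_sqnorm 0 openT)). Qed.

Lemma sqnorm_ge0 m (x : 'rV[R]_m) : 0 <= sqnorm x.
Proof. by apply: sumr_ge0 => i _; exact: sqr_ge0. Qed.

Lemma sqr_coord_le_sqnorm m (x : 'rV[R]_m) i : x 0 i ^+ 2 <= sqnorm x.
Proof.
by rewrite /sqnorm (bigD1 i)//= lerDl sumr_ge0// => j _; exact: sqr_ge0.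
Qed.

Lemma sqnorm_gt0 m (x : 'rV[R]_m) : x != 0 -> 0 < sqnorm x.
Proof.
move=> x0; rewrite lt_def sqnorm_ge0 andbT; apply: contra x0 => /eqP q0.
apply/eqP/rowP => i; rewrite mxE; apply/eqP; rewrite -sqrf_eq0 eq_le sqr_ge0 andbT.
by rewrite -q0 sqr_coord_le_sqnorm.
Qed.

Lemma sqnorm_tangential x :
  sqnorm (tangential x) = sqnorm x - vertical x ^+ 2.
Proof.
rewrite /sqnorm big_ord_recr /= /vertical addrK; apply: eq_bigr => i _.
rewrite mxE; congr (x _ _ ^+ 2); apply: val_inj => /=.
by rewrite /bump leqNgt ltn_ord.
Qed.

(** All the divergences and squared norms computed below are sums over [i] of
    polynomials of this shape in x_i and in the i-th coordinate of the vertical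
    unit vector, the latter being its own square. *)
Lemma sum_quadratic x (u0 u1 u2 u3 : R) :
  \sum_(i < n.+1) (u0 + u1 * x 0 i ^+ 2 + u2 * (i == ord_max)%:R
                   + u3 * ((i == ord_max)%:R * x 0 i)) =
  n.+1%:R * u0 + u1 * sqnorm x + u2 + u3 * vertical x.
Proof.
rewrite !big_split /= sumr_const card_ord mulr_natl -!mulr_sumr.
have E (f : 'I_n.+1 -> R) : \sum_(i < n.+1) (i == ord_max)%:R * f i = f ord_max.
  rewrite (bigD1 ord_max)//= eqxx mul1r big1 ?addr0// => i im.
  by rewrite (negbTE im) mul0r.
have := E (fun=> 1); under eq_bigr do rewrite mulr1.
by move=> ->; rewrite E mulr1.
Qed.

Lemma open_sqnorm_gt m (r : R) : open [set x : 'rV[R]_m | r < sqnorm x].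
Proof.
rewrite (_ : [set _ | _] = @sqnorm R m @^-1` [set t | r < t])//.
by apply: open_comp => [x _|]; [exact: continuous_sqnorm|exact: open_gt].
Qed.

Lemma open_sqnorm_lt m (r : R) : open [set x : 'rV[R]_m | sqnorm x < r].
Proof.
rewrite (_ : [set _ | _] = @sqnorm R m @^-1` [set t | t < r])//.
by apply: open_comp => [x _|]; [exact: continuous_sqnorm|exact: open_lt].
Qed.

Lemma paraboloidE (gamma : R) x : paraboloid gamma x <->
  0 < vertical x - gamma * (sqnorm x - vertical x ^+ 2).
Proof. by rewrite /paraboloid /= sqnorm_tangential subr_gt0. Qed.

Lemma not_paraboloid0 (gamma : R) : ~ @paraboloid R n gamma 0.
Proof.
move=> /paraboloidE; rewrite /vertical mxE /sqnorm big1 => [|i _].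
  by rewrite expr0n /= subr0 mulr0 subr0 ltxx.
by rewrite mxE expr0n.
Qed.

End coordinates.

Lemma small_radius (R : realType) (N d eps : R) :
  0 < N -> 0 < d -> 0 < eps ->
  let delta := eps / (4 * (N + eps) * d) in
  [/\ 0 < delta, d * (2 * delta) <= 1 / 2 & (N + eps) * d * (2 * delta) <= eps].
Proof.
move=> N0 d0 e0; have Ne : 0 < N + eps by rewrite addr_gt0.
split; first by rewrite divr_gt0 ?mulr_gt0.
- have -> : d * (2 * (eps / (4 * (N + eps) * d))) = eps / (2 * (N + eps)).
    by field; rewrite !gt_eqF.
  rewrite ler_pdivrMr ?mulr_gt0//.
  have -> : 1 / 2 * (2 * (N + eps)) = N + eps by field.
  by rewrite lerDr ltW.
- have -> : (N + eps) * d * (2 * (eps / (4 * (N + eps) * d))) = eps / 2.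
    by field; rewrite !gt_eqF.
  by lra.
Qed.

(** Here q = |x|^2 and s = x_N at a point of the ball of radius 2 delta above
    the paraboloid, with gamma = - c / 2. Everything is compared with
    T = s + c q, which dominates |s| and c q / 2. *)
Section comparison_inequalities.
Context {R : realType}.
Variables (N c delta eps q s : R).
Hypotheses (N0 : 0 < N) (c0 : 0 < c) (eps0 : 0 < eps) (delta0 : 0 < delta).
Let d := c * N / 2.
Hypotheses (hd1 : d * (2 * delta) <= 1 / 2)
  (hd2 : (N + eps) * d * (2 * delta) <= eps).
Hypotheses (q0 : 0 < q) (qd : q < 4 * delta ^+ 2) (sq : s ^+ 2 <= q)
  (hs : - (c / 2) * (q - s ^+ 2) < s).
Let P := s + c * q - d * s ^+ 2.

Let T_gt : c * q / 2 < s + c * q.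
Proof.
have : 0 <= c * s ^+ 2 by rewrite mulr_ge0 ?sqr_ge0// ltW.
by move: hs; lra.
Qed.

Let abs_s : `|s| <= 2 * delta.
Proof.
rewrite -(@ler_pXn2r _ 2) ?nnegrE ?mulr_ge0 ?(ltW delta0)//.
by rewrite real_normK ?num_real// exprMn (le_trans sq)// ltW// -natrX.
Qed.

Let abs_sT : `|s| <= s + c * q.
Proof.
have cq : 0 < c * q by rewrite mulr_gt0.
by rewrite ler_norml; apply/andP; split; move: T_gt cq; lra.
Qed.

Let s2T : s ^+ 2 <= 2 * delta * (s + c * q).
Proof.
rewrite -real_normK ?num_real// expr2.
by apply: ler_pM.
Qed.

Lemma comparison_gt : s + c * q <= 2 * P.
Proof.
have d0 : 0 < d by rewrite /d divr_gt0 ?mulr_gt0.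
have T0 : 0 < s + c * q by apply: le_lt_trans T_gt; rewrite divr_ge0 ?mulr_ge0 ?ltW.
have : d * s ^+ 2 <= d * (2 * delta * (s + c * q)) by rewrite ler_pM2l.
have : d * (2 * delta) * (s + c * q) <= 1 / 2 * (s + c * q) by rewrite ler_pM2r.
rewrite /P; lra.
Qed.

Lemma comparison_gt0 : 0 < P.
Proof.
have := comparison_gt; have := T_gt.
have : 0 < c * q by rewrite mulr_gt0.
lra.
Qed.

(** With phi = |x|^(-N/2) P the left-hand side is (Delta phi) / phi. The choice
    d = c N / 2 cancels the terms of order q, and what remains is
    eps T - (N + eps) d s^2, where s^2 <= 2 delta T. *)
Lemma comparison_superharmonic :
  - (N ^+ 2 / 4 + N) / q + (2 * c * N - 2 * d + N * s / q) / P <=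
  - (N ^+ 2 / 4 - eps) / q.
Proof.
have P0 := comparison_gt0.
rewrite -subr_ge0.
have -> : - (N ^+ 2 / 4 - eps) / q -
  (- (N ^+ 2 / 4 + N) / q + (2 * c * N - 2 * d + N * s / q) / P) =
  ((N + eps) * P - (c * N * q + N * s)) / (q * P).
  by rewrite /d; field; rewrite !gt_eqF.
apply: divr_ge0; last by rewrite mulr_ge0// ltW.
have d0 : 0 < d by rewrite /d divr_gt0 ?mulr_gt0.
have T0 : 0 < s + c * q by apply: le_lt_trans T_gt; rewrite divr_ge0 ?mulr_ge0 ?ltW.
have h1 : (N + eps) * d * s ^+ 2 <= (N + eps) * d * (2 * delta * (s + c * q)).
  by rewrite ler_pM2l// mulr_gt0// addr_gt0.
have h2 : (N + eps) * d * (2 * delta) * (s + c * q) <= eps * (s + c * q).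
  by rewrite ler_pM2r.
rewrite /P; lra.
Qed.

Lemma comparison_radial : - (N / 2) <= - (N / 2) + (2 * P - s) / P.
Proof.
rewrite lerDl divr_ge0 ?ltW ?comparison_gt0//.
have := comparison_gt; have : 0 < c * q by rewrite mulr_gt0.
lra.
Qed.
End comparison_inequalities.

Section cutoff.
Context {R : realType}.

Lemma cutoff_ge (D q : R) : 0 < D -> 0 <= q -> 1 - 2 * q / D <= sqpos (1 - q / D).
Proof.
move=> D0 q0; rewrite /sqpos -mulrA; have : 0 <= q / D by rewrite divr_ge0// ltW.
move: (q / D) => z z0; rewrite maxEle; case: ifPn => h; nra.
Qed.

(** The divergence of F = chi G plus |F|^2, for the cutoff chi = m^2: as
    chi^2 <= chi, truncation costs only the terms with 1 - chi, which is at most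
    2 q / D, and with the derivative of chi, where G enters through x.G. *)
Lemma cutoff_combination (K N D q m Gq Gx Gd : R) :
  0 <= K -> 0 <= N -> 0 < D -> 0 < q ->
  m = Num.max 0 (1 - q / D) ->
  0 <= Gq -> - (N / 2) <= Gx -> Gd + Gq <= - K / q ->
  (m ^+ 2) ^+ 2 * Gq - 4 / D * m * Gx + m ^+ 2 * Gd <=
  (2 * K + 2 * N) / D - K / q.
Proof.
move=> K0 N0 D0 q0 mE Gq0 hx hG.
have m0 : 0 <= m by rewrite mE le_max lexx.
have m1 : m <= 1 by rewrite mE ge_max ler01 gerBl divr_ge0// ltW.
have mq : 1 - 2 * q / D <= m ^+ 2 by have := cutoff_ge D0 (ltW q0); rewrite /sqpos -mE.
have mm : m ^+ 2 <= 1 by rewrite expr_le1.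
have h1 : (m ^+ 2) ^+ 2 * Gq <= m ^+ 2 * Gq.
  by rewrite ler_wpM2r// expr2 ler_piMl// sqr_ge0.
have h2 : m ^+ 2 * (Gd + Gq) <= m ^+ 2 * (- K / q) by rewrite ler_wpM2l// sqr_ge0.
have h3 : m ^+ 2 * (- K / q) <= 2 * K / D - K / q.
  have Kq : 0 <= K / q by rewrite divr_ge0// ltW.
  have : (1 - 2 * q / D) * (K / q) <= m ^+ 2 * (K / q) by rewrite ler_wpM2r.
  have -> : (1 - 2 * q / D) * (K / q) = K / q - 2 * K / D.
    by field; rewrite !gt_eqF.
  lra.
have h4 : - (4 / D * m * Gx) <= 2 * N / D.
  have D4 : 0 <= 4 / D * m by rewrite mulr_ge0// divr_ge0// ltW.
  have : 4 / D * m * - (N / 2) <= 4 / D * m * Gx by rewrite ler_wpM2l.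
  have : 4 / D * m * (N / 2) <= 4 / D * (N / 2).
    by rewrite ler_wpM2r ?divr_ge0// ler_piMr// divr_ge0// ltW.
  have -> : 4 / D * (N / 2) = 2 * N / D by field; rewrite gt_eqF.
  lra.
have -> : (2 * K + 2 * N) / D = 2 * K / D + 2 * N / D by rewrite mulrDl.
lra.
Qed.
End cutoff.

(** * The vector field of the Hardy inequality *)

Section vector_field.
Context {R : realType} {n : nat}.
Implicit Types x : 'rV[R]_n.+1.
Variables (c d D : R).
Let N : R := n.+1%:R.

(** |x|^(-N/2) [comparison] replaces |x|^(-N/2) x_N, which satisfies the equality
    - Delta phi = (N^2/4) phi / |x|^2 in the half-space but is not positive on
    the paraboloid. *)
Definition comparison x : R := vertical x + c * sqnorm x - d * vertical x ^+ 2.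

(** The gradient of the logarithm of |x|^(-N/2) [comparison x]. *)
Definition log_gradient (i : 'I_n.+1) x : R :=
  - (N / 2) * (x 0 i / sqnorm x) +
  ((i == ord_max)%:R * (1 - 2 * d * vertical x) + 2 * c * x 0 i) / comparison x.

Definition log_gradient_partial (i : 'I_n.+1) x : R :=
  - (N / 2) * (1 / sqnorm x - 2 * x 0 i ^+ 2 / sqnorm x ^+ 2) +
  (2 * c - 2 * d * (i == ord_max)%:R * (i == ord_max)%:R) / comparison x -
  ((i == ord_max)%:R * (1 - 2 * d * vertical x) + 2 * c * x 0 i) ^+ 2
    / comparison x ^+ 2.

Lemma Ck_comparison k (U : set 'rV[R]_n.+1) : open U -> Ck k U comparison.
Proof.
move=> oU; apply: CkD => //.
  by apply: CkD; [|exact: Ck_coord|apply: CkZ => //; exact: Ck_sqnorm].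
under eq_fun do rewrite -mulNr expr2.
by apply: CkZ => //; apply: CkM => //; exact: Ck_coord.
Qed.

Lemma Ck_log_gradient k i (U : set 'rV[R]_n.+1) : open U ->
  (forall x, U x -> sqnorm x != 0) -> (forall x, U x -> comparison x != 0) ->
  Ck k U (log_gradient i).
Proof.
move=> oU q0 P0; apply: CkD => //.
  apply: CkZ => //; apply: CkM => //; first exact: Ck_coord.
  by apply: CkV => //; exact: Ck_sqnorm.
apply: CkM => //; last by apply: CkV => //; exact: Ck_comparison.
apply: CkD => //; last by apply: CkZ => //; exact: Ck_coord.
apply: CkZ => //.
under eq_fun do rewrite -mulNr.
by apply: CkD => //; [exact: Ck_cst|apply: CkZ => //; exact: Ck_coord].
Qed.

Lemma is_derive_comparison i x :
  is_derive x (delta_mx 0 i) (comparison : _ -> R^o)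
    ((i == ord_max)%:R * (1 - 2 * d * vertical x) + 2 * c * x 0 i).
Proof.
have D1 := is_derive_coord i ord_max x.
have D2 := is_derive_scale c (is_derive_sqnorm i x).
have D3 := is_derive_scale (- d) (is_derive_pow 2 D1).
have := is_derive_add (is_derive_add D1 D2) D3.
apply: is_derive_ext => [y|]; first by rewrite mulNr.
by rewrite /vertical /=; ring.
Qed.

Lemma is_derive_log_gradient i x : sqnorm x != 0 -> comparison x != 0 ->
  is_derive x (delta_mx 0 i) (log_gradient i : _ -> R^o) (log_gradient_partial i x).
Proof.
move=> q0 P0.
have Di := is_derive_coord i i x.
have Dq := is_derive_inv q0 (is_derive_sqnorm i x).
have DP := is_derive_inv P0 (is_derive_comparison i x).
have Ds := is_derive_add (is_derive_cst (1 : R^o) x (delta_mx 0 i : 'rV[R]_n.+1))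
   (is_derive_scale (- (2 * d)) (is_derive_coord i ord_max x)).
have Dn := is_derive_add (is_derive_scale (i == ord_max)%:R Ds) (is_derive_scale (2 * c) Di).
have := is_derive_add (is_derive_scale (- (N / 2)) (is_derive_mul Di Dq)) (is_derive_mul Dn DP).
apply: is_derive_ext => [y|]; first by rewrite /= [- (2 * d) * _]mulNr.
rewrite /log_gradient_partial /vertical /= eqxx -[true%:R]/(1 : R).
by set S := (i == ord_max)%:R; field; rewrite P0 q0.
Qed.

Lemma sum_log_gradient_radial x : sqnorm x != 0 -> comparison x != 0 ->
  \sum_i x 0 i * log_gradient i x =
  - (N / 2) + (2 * comparison x - vertical x) / comparison x.
Proof.
move=> q0 P0.
rewrite (eq_bigr (fun i => 0 + (- (N / 2) / sqnorm x + 2 * c / comparison x) * x 0 i ^+ 2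
  + 0 * (i == ord_max)%:R
  + (1 - 2 * d * vertical x) / comparison x * ((i == ord_max)%:R * x 0 i))).
  rewrite sum_quadratic; move: P0 q0; rewrite /comparison => P0 q0.
  by field; rewrite ?P0 ?q0.
by move=> i _; rewrite /log_gradient; field; rewrite ?P0 ?q0.
Qed.

Lemma sum_log_gradient_divergence x : sqnorm x != 0 -> comparison x != 0 ->
  \sum_i log_gradient_partial i x + \sum_i log_gradient i x ^+ 2 =
  - (N ^+ 2 / 4 + N) / sqnorm x +
  (2 * c * N - 2 * d + N * vertical x / sqnorm x) / comparison x.
Proof.
move=> q0 P0; rewrite -big_split/=.
pose q := sqnorm x; pose P := comparison x; pose A := 1 - 2 * d * vertical x.
pose al := - (N / 2) / q + 2 * c / P; pose be := A / P.
rewrite (eq_bigr (fun i => al + (al ^+ 2 + N / q ^+ 2 - 4 * c ^+ 2 / P ^+ 2) * x 0 i ^+ 2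
  + (be ^+ 2 - 2 * d / P - A ^+ 2 / P ^+ 2) * (i == ord_max)%:R
  + (2 * al * be - 4 * c * A / P ^+ 2) * ((i == ord_max)%:R * x 0 i))).
  rewrite sum_quadratic -/q /al /be /A /P; move: P0 q0; rewrite /comparison -/q => P0 q0.
  by field; rewrite ?P0 ?q0.
move=> i _; rewrite /log_gradient /log_gradient_partial /al /be /A.
rewrite -/q -/P; move: q0 P0; rewrite -/q -/P => q0 P0.
by case: (i == ord_max) => /=; rewrite ?mulr1n ?mulr0n; field; rewrite ?P0 ?q0.
Qed.

Variable v : 'rV[R]_n.+1 -> R.

Definition flux (i : 'I_n.+1) x : R :=
  v x ^+ 2 * (sqpos (1 - sqnorm x / D) * log_gradient i x).

Lemma C1_cutoff (U : set 'rV[R]_n.+1) : open U ->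
  Ck 1 U (fun x => sqpos (1 - sqnorm x / D)).
Proof.
move=> oU; apply: C1_sqpos => //.
under eq_fun do rewrite mulrC -mulNr.
by apply: CkD => //; [exact: Ck_cst|apply: CkZ => //; exact: Ck_sqnorm].
Qed.

Lemma is_derive_flux i x : smooth_on setT v ->
  sqnorm x != 0 -> comparison x != 0 ->
  let m := Num.max 0 (1 - sqnorm x / D) in
  is_derive x (delta_mx 0 i) (flux i : _ -> R^o)
   (2 * v x * partial i v x * (m ^+ 2 * log_gradient i x) +
    v x ^+ 2 * (- (4 / D) * m * (x 0 i * log_gradient i x) +
      m ^+ 2 * log_gradient_partial i x)).
Proof.
move=> sv q0 P0 m.
have Dv := is_derive_pow 2 (Ck_derive i (sv 1%N) I : is_derive x _ _ _).
have Dq := is_derive_add (is_derive_cst (1 : R^o) x (delta_mx 0 i : 'rV[R]_n.+1))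
   (is_derive_scale (- D^-1) (is_derive_sqnorm i x)).
have {}Dq : is_derive x (delta_mx 0 i) ((fun y => 1 - sqnorm y / D) : _ -> R^o)
    (- D^-1 * (2 * x 0 i)).
  by apply: is_derive_ext Dq => [y|]; rewrite /= ?add0r// mulNr mulrC.
have Dm := is_derive_comp (is_derive_sqpos _) Dq.
apply: (is_derive_eq (is_derive_mul Dv (is_derive_mul Dm (is_derive_log_gradient i q0 P0)))).
by rewrite /= -/m /sqpos -/m; ring.
Qed.

(** The difference of both sides is the square of grad v - chi v G. *)
Lemma divergence_flux_le x m : smooth_on setT v ->
  sqnorm x != 0 -> comparison x != 0 ->
  m = Num.max 0 (1 - sqnorm x / D) ->
  \sum_i partial i (flux i) x <= sqnorm (gradient v x) +
    v x ^+ 2 * ((m ^+ 2) ^+ 2 * (\sum_i log_gradient i x ^+ 2)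
      - 4 / D * m * (\sum_i x 0 i * log_gradient i x)
      + m ^+ 2 * \sum_i log_gradient_partial i x).
Proof.
move=> sv q0 P0 mE.
rewrite !mulr_sumr -sumrB -big_split /= mulr_sumr /sqnorm -big_split /=.
apply: ler_sum => i _; rewrite (partial_is_derive (is_derive_flux i sv q0 P0)) mxE -mE.
rewrite -subr_ge0.
set a := partial i v x; set G := log_gradient i x.
rewrite [X in 0 <= X](_ : _ = (a - m ^+ 2 * v x * G) ^+ 2) ?sqr_ge0//.
ring.
Qed.

End vector_field.

(** * Compactly supported integrands *)

Section compact_support.
Context {R : realType} {n : nat}.
Implicit Types (f g : 'rV[R]_n -> R) (S Omega : set 'rV[R]_n).

Definition vanish_off S f := forall x, ~ S x -> f x = 0.

Lemma vanish_off_bounded S f : compact S -> vanish_off S f -> bounded_support f.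
Proof.
move=> cS fS; have [M [_ MP]] := compact_bounded cS.
exists (`|M| + 1) => x xM; apply: fS => Sx.
have : M < `|M| + 1 by rewrite (le_lt_trans (ler_norm M))// ltrDl.
by move/MP => /(_ x Sx) /=; rewrite leNgt xM.
Qed.

Lemma vanish_off_partial S f i : closed S -> vanish_off S f ->
  vanish_off S (partial i f).
Proof.
move=> cS fS x Sx; apply: partial_is_derive.
apply: (near_eq_is_derive (f := cst 0)).
have : nbhs x (~` S) by apply: open_nbhs_nbhs; split => //; exact: closed_openC.
by apply: filterS => y /fS ->.
Qed.

Lemma integral_vanish_off S Omega f : measurable Omega -> S `<=` Omega ->
  vanish_off S f ->
  (\int[lebN n]_(x in Omega) (f x)%:E = \int[lebN n]_x (f x)%:E)%E.
Proof.
move=> mO SO fS; rewrite integral_mkcond; apply: eq_integral => x _.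
rewrite patchE; case: ifPn => // /negP xO; rewrite fS// => /SO Ox.
by apply: xO; rewrite inE.
Qed.

Definition Cc f := continuous f /\ bounded_support f.

Lemma Cc_integrable f : Cc f -> (@lebN R n).-integrable setT (EFin \o f).
Proof. by case; exact: bounded_support_integrable. Qed.

Lemma integral_Cc f : Cc f ->
  (\int[lebN n]_x (f x)%:E = (\int[lebN n]_x f x)%:E)%E.
Proof.
move=> Cf; rewrite /Rintegral fineK//.
exact/integrable_fin_num/Cc_integrable.
Qed.

Lemma CcD f g : Cc f -> Cc g -> Cc (fun x => f x + g x).
Proof.
move=> [cf [M fM]] [cg [M' gM]]; split; first by move=> x; exact: (cvgD (cf x) (cg x)).
by exists (Num.max M M') => x; rewrite gt_max => /andP[/fM -> /gM ->]; rewrite addr0.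
Qed.

Lemma CcZ c f : Cc f -> Cc (fun x => c * f x).
Proof.
move=> [cf [M fM]]; split; last by exists M => x /fM ->; rewrite mulr0.
have C0 : Ck 0 setT f by split => // x _; exact: cf.
by move=> x; exact: (Ck_continuous (CkZ c openT C0) (I : setT x)).
Qed.

Lemma CcM f g : Cc f -> Cc g -> Cc (fun x => f x * g x).
Proof.
move=> [cf [M fM]] [cg _]; split; last by exists M => x /fM ->; rewrite mul0r.
have Cf : Ck 0 setT f by split => // x _; exact: cf.
have Cg : Ck 0 setT g by split => // x _; exact: cg.
by move=> x; exact: (Ck_continuous (CkM openT Cf Cg) (I : setT x)).
Qed.

Lemma Rintegral_CcD f g : Cc f -> Cc g ->
  \int[lebN n]_x (f x + g x) = \int[lebN n]_x f x + \int[lebN n]_x g x.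
Proof. by move=> /Cc_integrable fi /Cc_integrable gi; exact: RintegralD. Qed.

Lemma Rintegral_CcZ c f : Cc f ->
  \int[lebN n]_x (c * f x) = c * \int[lebN n]_x f x.
Proof. by move=> /Cc_integrable fi; exact: RintegralZl. Qed.

Lemma le_Rintegral_Cc f g : Cc f -> Cc g -> (forall x, f x <= g x) ->
  \int[lebN n]_x f x <= \int[lebN n]_x g x.
Proof.
by move=> /Cc_integrable fi /Cc_integrable gi fg; apply: le_Rintegral.
Qed.

Lemma partial_Cc i f : Ck 1 setT f -> bounded_support f -> Cc (partial i f).
Proof.
move=> Cf [M fM]; split.
  by move=> x; exact: (Ck_continuous (Ck_partial i Cf) (I : setT x)).
exists M => x Mx; apply: (@vanish_off_partial [set y | `|y| <= M]).
- rewrite (_ : [set _ | _] = (fun x : 'rV[R]_n => `|x|) @^-1` [set t | t <= M])//.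
  by apply: closed_comp => [y _|]; [exact: norm_continuous|exact: closed_le].
- by move=> y /= /negP; rewrite -ltNge => /fM.
- by apply/negP; rewrite -ltNge.
Qed.

Lemma Rintegral_partial_eq0 i f : Ck 1 setT f -> bounded_support f ->
  \int[lebN n]_x partial i f x = 0.
Proof.
move=> Cf bf; have [cp bp] := partial_Cc i Cf bf.
have fd x : is_derive x (delta_mx 0 i) (f : _ -> R^o) (partial i f x).
  exact: (Ck_derive i Cf (I : setT x)).
by rewrite /Rintegral (integral_partial_eq0 fd).
Qed.

(** The divergence theorem for compactly supported C^1 vector fields. *)
Lemma Rintegral_divergence_eq0 m (s : 'I_m -> 'I_n) (w : 'I_m -> 'rV[R]_n -> R) :
  (forall j, Ck 1 setT (w j)) -> (forall j, bounded_support (w j)) ->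
  Cc (fun x => \sum_(j < m) partial (s j) (w j) x) /\
  \int[lebN n]_x (\sum_(j < m) partial (s j) (w j) x) = 0.
Proof.
elim: m s w => [|m IH] s w Cw bw.
  under eq_fun do rewrite big_ord0; split.
    by split; [exact: cst_continuous|exists 0].
  by rewrite /Rintegral integral0.
have [C0 I0] := IH (fun j => s (lift ord0 j)) (fun j => w (lift ord0 j))
  (fun j => Cw _) (fun j => bw _).
have C1 := partial_Cc (s ord0) (Cw ord0) (bw ord0).
have -> : (fun x => \sum_(j < m.+1) partial (s j) (w j) x) = (fun x =>
    partial (s ord0) (w ord0) x + \sum_(j < m) partial (s (lift ord0 j)) (w (lift ord0 j)) x).
  by apply/funext => x; rewrite big_ord_recl.
split; first exact: CcD.
by rewrite Rintegral_CcD// I0 addr0 Rintegral_partial_eq0.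
Qed.

End compact_support.

Section test_functions.
Context {R : realType} {n : nat}.
Variables (Omega : set 'rV[R]_n) (v : 'rV[R]_n -> R).
Hypothesis tv : test_function Omega v.
Let S := closure [set x | v x != 0].

Lemma test_vanish : vanish_off S v.
Proof.
move=> x Sx; apply: contrapT => /eqP vx; apply: Sx; exact: subset_closure.
Qed.

Lemma test_Ck k : Ck k setT v. Proof. by case: tv. Qed.

Lemma test_compact : compact S. Proof. by case: tv. Qed.

Lemma test_sub : S `<=` Omega. Proof. by case: tv. Qed.

Lemma test_closed : closed S. Proof. exact: closed_closure. Qed.

Lemma vanish_Cc g : continuous g -> vanish_off S g -> Cc g.
Proof. by move=> cg gS; split => //; exact: vanish_off_bounded test_compact _. Qed.

Lemma test_partial_vanish i : vanish_off S (partial i v).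
Proof. exact: vanish_off_partial test_closed test_vanish. Qed.

Lemma test_continuous : continuous v.
Proof. by move=> x; exact: (Ck_continuous (test_Ck 0) (I : setT x)). Qed.

Lemma test_sqr_continuous : continuous (fun x => v x ^+ 2).
Proof.
by move=> x; exact: (Ck_continuous (CkM openT (test_Ck 0) (test_Ck 0)) (I : setT x)).
Qed.

Lemma test_sqr_vanish : vanish_off S (fun x => v x ^+ 2).
Proof. by move=> x /test_vanish ->; rewrite expr0n. Qed.

Lemma test_sqr_Cc : Cc (fun x => v x ^+ 2).
Proof. exact: vanish_Cc test_sqr_continuous test_sqr_vanish. Qed.

Lemma test_grad_vanish : vanish_off S (fun x => sqnorm (gradient v x)).
Proof.
by move=> x Sx; apply: big1 => i _; rewrite mxE test_partial_vanish// expr0n.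
Qed.

Lemma test_grad_Cc : Cc (fun x => sqnorm (gradient v x)).
Proof.
apply: vanish_Cc test_grad_vanish => x.
have C : Ck 0 setT (fun x => \sum_(i < n) partial i v x * partial i v x).
  apply: Ck_sum openT _ => i; apply: CkM openT _ _; exact: Ck_partial (test_Ck 1).
have -> : (fun x => sqnorm (gradient v x)) =
   (fun x => \sum_(i < n) partial i v x * partial i v x).
  by apply/funext => y; apply: eq_bigr => i _; rewrite mxE.
exact: (Ck_continuous C (I : setT x)).
Qed.

Lemma test_quotient_vanish : vanish_off S (fun x => v x ^+ 2 / sqnorm x).
Proof. by move=> x Sx; rewrite test_sqr_vanish// mul0r. Qed.

Lemma test_quotient_Cc : ~ Omega 0 -> Cc (fun x => v x ^+ 2 / sqnorm x).
Proof.
move=> O0; apply: vanish_Cc test_quotient_vanish => x.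
have oS : open (~` S) by apply: closed_openC; exact: test_closed.
have [Sx|Sx] := pselect (S x); last first.
  apply: near_eq_continuous (@cst_continuous _ _ (0 : R) x).
  have : nbhs x (~` S) by apply: open_nbhs_nbhs; split.
  by apply: filterS => y /test_quotient_vanish ->.
have x0 : sqnorm x != 0.
  rewrite gt_eqF// sqnorm_gt0//; apply/eqP => x0; apply: O0; rewrite -x0.
  exact: test_sub.
exact: (cvgM (@test_sqr_continuous x) (cvgV x0 (@continuous_sqnorm _ _ x))).
Qed.

End test_functions.

(** * The Hardy inequality for test functions *)

Section hardy_test_functions.
Context {R : realType} {n : nat}.
Variables (Omega : set 'rV[R]_n.+1) (gamma eps : R).
Hypotheses (gamma0 : gamma < 0) (eps0 : 0 < eps) (oO : open Omega)
  (sub : Omega `<=` paraboloid gamma).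
Let N : R := n.+1%:R.
Let K := N ^+ 2 / 4 - eps.
Hypothesis K0 : 0 <= K.

Let c := - 2 * gamma.
Let d := c * N / 2.
Let delta := eps / (4 * (N + eps) * d).
Let D := delta ^+ 2.

Let N0 : 0 < N. Proof. by rewrite ltr0n. Qed.
Let c0 : 0 < c. Proof. by rewrite /c; move: gamma0; lra. Qed.
Let d0 : 0 < d. Proof. by rewrite /d divr_gt0 ?(mulr_gt0 c0 N0). Qed.
Let delta0 : 0 < delta. Proof. by case: (small_radius N0 d0 eps0). Qed.
Let hd1 : d * (2 * delta) <= 1 / 2. Proof. by case: (small_radius N0 d0 eps0). Qed.
Let hd2 : (N + eps) * d * (2 * delta) <= eps.
Proof. by case: (small_radius N0 d0 eps0). Qed.
Let D0 : 0 < D. Proof. exact: exprn_gt0. Qed.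

Let not0 : ~ Omega 0.
Proof. by move=> /sub; exact: not_paraboloid0. Qed.

Let q_gt0 x : Omega x -> 0 < sqnorm x.
Proof. by move=> Ox; apply: sqnorm_gt0; apply/eqP => x0; apply: not0; rewrite -x0. Qed.

Let vertical_le (x : 'rV[R]_n.+1) : vertical x ^+ 2 <= sqnorm x.
Proof. exact: sqr_coord_le_sqnorm. Qed.

Let vertical_gt x : Omega x ->
  - (c / 2) * (sqnorm x - vertical x ^+ 2) < vertical x.
Proof.
move=> /sub; rewrite /paraboloid /= sqnorm_tangential.
by have -> : - (c / 2) = gamma by rewrite /c; field.
Qed.

Let P_gt0 x : Omega x -> sqnorm x < 4 * D -> 0 < comparison c d x.
Proof.
move=> Ox qD.
exact: (comparison_gt0 N0 c0 delta0 hd1 (q_gt0 Ox) qD (vertical_le x) (vertical_gt Ox)).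
Qed.

Variable v : 'rV[R]_n.+1 -> R.
Hypothesis tv : test_function Omega v.
Let S := closure [set x | v x != 0].
Let w := flux c d D v.

(** The flux is of class C^1 on each of three open sets covering the space: on
   near_domain the comparison function is positive, on far_domain the cutoff
   vanishes, off S the test function does. *)
Let near_domain := Omega `&` [set x | sqnorm x < 4 * D].
Let far_domain : set 'rV[R]_n.+1 := [set x | D < sqnorm x].

Let open_near : open near_domain.
Proof. by apply: openI => //; exact: open_sqnorm_lt. Qed.

Let open_far : open far_domain.
Proof. exact: open_sqnorm_gt. Qed.

Let open_off : open (~` S).
Proof. by apply: closed_openC; exact: closed_closure. Qed.

Let cover x : S x -> near_domain x \/ far_domain x.
Proof.
move=> Sx; have [Dq|qD] := ltP D (sqnorm x); first by right.
left; split; first exact: (test_sub tv).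
rewrite /= (le_lt_trans qD)// ltr_pMl// ltr1n.
by [].
Qed.

Let flux_far i x : far_domain x -> w i x = 0.
Proof.
rewrite /far_domain /= => Dq; rewrite /w /flux /sqpos max_l ?expr0n ?mul0r ?mulr0//.
by rewrite subr_le0 ler_pdivlMr// mul1r ltW.
Qed.

Let flux_off i : vanish_off S (w i).
Proof. by move=> x Sx; rewrite /w /flux (test_vanish Sx)// expr0n mul0r. Qed.

Let C1_flux i : Ck 1 setT (w i).
Proof.
have -> : setT = near_domain `|` far_domain `|` ~` S.
  apply/seteqP; split => // x _.
  by have [/cover[]|] := pselect (S x); [left; left|left; right|right].
apply: CkU; first apply: CkU.
- apply: CkM open_near _ _; last apply: CkM open_near _ _.
  + under eq_fun do rewrite expr2.
    by apply: CkM open_near _ _; apply: Ck_sub (test_Ck tv 1).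
  + exact: C1_cutoff.
  + apply: Ck_log_gradient => // x [Ox qD]; rewrite gt_eqF//; first exact: q_gt0.
    exact: P_gt0.
- by apply: (Ck_eq (f := fun=> 0)) => [//|x /flux_far ->//|]; exact: Ck_cst.
- by apply: (Ck_eq (f := fun=> 0)) => [//|x /flux_off ->//|]; exact: Ck_cst.
Qed.

Definition hardy_remainder : R := (2 * K + 2 * N) / D.

Let partial_eq0 i (U : set 'rV[R]_n.+1) x : open U -> U x ->
  (forall y, U y -> w i y = 0) -> partial i (w i) x = 0.
Proof.
move=> oU Ux wU; apply: partial_is_derive.
apply: (near_eq_is_derive (f := cst 0)).
have : nbhs x U by apply: open_nbhs_nbhs.
by apply: filterS => y /wU ->.
Qed.

Let pointwise x : K * (v x ^+ 2 / sqnorm x) + \sum_i partial i (w i) x <=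
  sqnorm (gradient v x) + hardy_remainder * v x ^+ 2.
Proof.
have C0 : 0 <= hardy_remainder.
  by rewrite divr_ge0 ?(ltW D0)// addr_ge0 ?mulr_ge0// ltW.
have [Sx|Sx] := pselect (S x); last first.
  rewrite (test_vanish Sx)// expr0n !(mul0r, mulr0) add0r addr0 big1 ?sqnorm_ge0// => i _.
  exact: partial_eq0 open_off Sx (@flux_off i).
have Ox := test_sub tv Sx; have qx := q_gt0 Ox.
case: (cover Sx) => [[_ qD]|Dq]; last first.
  rewrite big1 ?addr0 => [|i _]; last exact: partial_eq0 open_far Dq (@flux_far i).
  rewrite ler_wpDl ?sqnorm_ge0// mulrCA [leRHS]mulrC ler_wpM2l ?sqr_ge0//.
  have : K / sqnorm x <= K / D by rewrite ler_wpM2l// lef_pV2// ltW.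
  move/le_trans; apply.
  by rewrite ler_pM2r ?invr_gt0//; move: (ltW N0) K0; lra.
have Px := P_gt0 Ox qD.
have := @divergence_flux_le _ _ c d D v x _ (fun k => test_Ck tv k)
  (lt0r_neq0 qx) (lt0r_neq0 Px) erefl.
rewrite -/w => /(lerD (lexx (K * (v x ^+ 2 / sqnorm x)))) /le_trans; apply.
rewrite addrCA lerD2l mulrCA -mulrDr [leRHS]mulrC ler_wpM2l ?sqr_ge0// addrC -lerBrDr.
apply: cutoff_combination => //.
- by apply: sumr_ge0 => i _; exact: sqr_ge0.
- rewrite sum_log_gradient_radial ?gt_eqF//.
  exact: (comparison_radial N0 c0 delta0 hd1 qx qD (vertical_le x) (vertical_gt Ox)).
- rewrite sum_log_gradient_divergence ?gt_eqF//.
  exact: (comparison_superharmonic N0 c0 eps0 delta0 hd1 hd2 qx qD (vertical_le x) (vertical_gt Ox)).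
Qed.

Lemma hardy_test_Rintegral :
  K * \int[lebN n.+1]_x (v x ^+ 2 / sqnorm x) <=
  \int[lebN n.+1]_x (sqnorm (gradient v x)) + hardy_remainder * \int[lebN n.+1]_x (v x ^+ 2).
Proof.
have [Cd Id] := Rintegral_divergence_eq0 id C1_flux
  (fun i => vanish_off_bounded (test_compact tv) (@flux_off i)).
have Cq := test_quotient_Cc tv not0; have Cg := test_grad_Cc tv.
have Cs := test_sqr_Cc tv.
rewrite -!Rintegral_CcZ// -Rintegral_CcD//; last exact: CcZ.
rewrite -[leLHS]addr0 -Id -Rintegral_CcD//; last exact: CcZ.
by apply: le_Rintegral_Cc; [apply: CcD => //; exact: CcZ|apply: CcD => //; exact: CcZ|exact: pointwise].
Qed.

End hardy_test_functions.

(** * From test functions to the Sobolev space *)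

Section density.
Context {R : realType} {n : nat}.
Implicit Types (Omega : set 'rV[R]_n) (f h v : 'rV[R]_n -> R).

Lemma ge0_le_integral_combination Omega (f1 f2 h : 'rV[R]_n -> R) (a b : R) :
  measurable Omega -> 0 <= a -> 0 <= b ->
  measurable_fun Omega f1 -> measurable_fun Omega f2 -> measurable_fun Omega h ->
  (forall x, 0 <= f1 x) -> (forall x, 0 <= f2 x) ->
  (forall x, Omega x -> 0 <= h x <= a * f1 x + b * f2 x) ->
  (\int[lebN n]_(x in Omega) (h x)%:E <=
   a%:E * \int[lebN n]_(x in Omega) (f1 x)%:E +
   b%:E * \int[lebN n]_(x in Omega) (f2 x)%:E)%E.
Proof.
move=> mO a0 b0 m1 m2 mh f10 f20 hf.
have M1 : measurable_fun Omega (EFin \o f1) by apply/measurable_EFinP.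
have M2 : measurable_fun Omega (EFin \o f2) by apply/measurable_EFinP.
have p1 x : Omega x -> (0 <= (f1 x)%:E)%E by rewrite lee_fin.
have p2 x : Omega x -> (0 <= (f2 x)%:E)%E by rewrite lee_fin.
rewrite -!ge0_integralZl_EFin//.
rewrite -ge0_integralD//.
- apply: ge0_le_integral => //.
  + by move=> x /hf /andP[].
  + by apply/measurable_EFinP.
  + by apply: emeasurable_funD; exact: measurable_funeM.
  + by move=> x /hf /andP[_]; rewrite -!EFinM -EFinD lee_fin.
- by move=> x _; rewrite -EFinM lee_fin mulr_ge0.
- exact: measurable_funeM.
- by move=> x _; rewrite -EFinM lee_fin mulr_ge0.
- exact: measurable_funeM.
Qed.

Lemma sqr_split (eta a b : R) : 0 < eta ->
  a ^+ 2 <= (1 + eta) * b ^+ 2 + (1 + eta^-1) * (b - a) ^+ 2.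
Proof.
move=> e0; rewrite -subr_ge0.
have -> : (1 + eta) * b ^+ 2 + (1 + eta^-1) * (b - a) ^+ 2 - a ^+ 2 =
  eta^-1 * ((1 + eta) * b - a) ^+ 2 by field; rewrite gt_eqF.
by rewrite mulr_ge0 ?invr_ge0 ?sqr_ge0// ltW.
Qed.

Lemma sqnorm_split m (eta : R) (a b : 'rV[R]_m) : 0 < eta ->
  sqnorm a <= (1 + eta) * sqnorm b + (1 + eta^-1) * sqnorm (b - a).
Proof.
move=> e0; rewrite /sqnorm !mulr_sumr -big_split/=; apply: ler_sum => i _.
by rewrite !mxE; exact: sqr_split.
Qed.

Lemma le_of_perturbation (X Y : R) (Z : R -> R) : 0 <= Y ->
  (forall eta e, 0 < eta <= 1 -> 0 < e -> X <= (1 + eta) ^+ 2 * Y + e * Z eta) ->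
  X <= Y.
Proof.
move=> Y0 H.
have H1 eta : 0 < eta <= 1 -> X <= (1 + eta) ^+ 2 * Y.
  move=> he; apply/ler_addgt0Pr => e e0.
  have Z0 : 0 < `|Z eta| + 1 by rewrite ltr_wpDl.
  have := H eta (e / (`|Z eta| + 1)) he (divr_gt0 e0 Z0).
  move/le_trans; apply; rewrite lerD2l mulrAC ler_pdivrMr// ler_pM2l//.
  by rewrite (le_trans (ler_norm _))// lerDl.
apply/ler_addgt0Pr => e e0.
pose eta := Num.min 1 (e / (3 * (Y + 1))).
have Y1 : 0 < 3 * (Y + 1) by rewrite mulr_gt0// ltr_wpDl.
have eta0 : 0 < eta by rewrite lt_min ltr01 divr_gt0.
have eta1 : eta <= 1 by rewrite ge_min lexx.
have eta2 : eta * (3 * (Y + 1)) <= e.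
  by rewrite -ler_pdivlMr// ge_min lexx orbT.
have := H1 eta; rewrite eta0 eta1 => /(_ isT) /le_trans; apply.
have : eta * Y * (1 - eta) >= 0 by rewrite mulr_ge0 ?mulr_ge0 ?subr_ge0// ltW.
nra.
Qed.

Lemma L2_measurable_sqr Omega f : measurable Omega -> measurable_fun Omega f ->
  measurable_fun Omega (fun x => f x ^+ 2).
Proof. by move=> mO mf; under eq_fun do rewrite expr2; exact: measurable_funM. Qed.

(** The weight is first replaced by the bounded weights 1/(|x|^2 + 1/(M+1)), for
    which the left-hand side is continuous in L^2; monotone convergence then
    restores it. The three integrals are compared with those of a nearby test
    function by (a + b)^2 <= (1 + eta) a^2 + (1 + 1/eta) b^2. *)
Lemma hardy_by_density Omega (C K : R) : open Omega -> ~ Omega 0 ->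
  0 <= C -> 0 <= K ->
  (forall phi, test_function Omega phi ->
    K * \int[lebN n]_x (phi x ^+ 2 / sqnorm x) <=
    \int[lebN n]_x (sqnorm (gradient phi x)) + C * \int[lebN n]_x (phi x ^+ 2)) ->
  hardy_inequality Omega C K.
Proof.
move=> oO O0 C0 K0 Htest v g [[[mv v2] Lg _] Hv].
have mO : measurable Omega by exact: open_measurable_rV.
have qpos x : Omega x -> 0 < sqnorm x.
  by move=> Ox; apply: sqnorm_gt0; apply/eqP => x0; apply: O0; rewrite -x0.
have mv2 : measurable_fun Omega (fun x => v x ^+ 2) by exact: L2_measurable_sqr.
have mg2 : measurable_fun Omega (fun x => sqnorm (g x)).
  by apply: measurable_sum => i; apply: L2_measurable_sqr => //; case: (Lg i).
set A := (\int[lebN n]_(x in Omega) (v x ^+ 2)%:E)%E in v2 *.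
set B := (\int[lebN n]_(x in Omega) (sqnorm (g x))%:E)%E.
have A0 : (0 <= A)%E by apply: integral_ge0 => x _; rewrite lee_fin sqr_ge0.
have B0 : (0 <= B)%E by apply: integral_ge0 => x _; rewrite lee_fin sqnorm_ge0.
case AE: A A0 v2 => [a| |]//; rewrite lee_fin => a0 _.
case BE: B B0 => [b| |]//; last by move=> _; rewrite -EFinM addey// leey.
rewrite lee_fin => b0.
pose om M (x : 'rV[R]_n) : R := (sqnorm x + M.+1%:R^-1)^-1.
have m0 M : 0 < (M.+1%:R : R)^-1 by rewrite invr_gt0.
have om0 M x : 0 < om M x by rewrite invr_gt0 ltr_wpDl// sqnorm_ge0.
have omM M x : om M x <= M.+1%:R.
  rewrite -[leRHS]invrK lef_pV2 ?posrE ?m0//; first by rewrite lerDr sqnorm_ge0.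
  by rewrite ltr_wpDl// sqnorm_ge0.
have omq M x : Omega x -> om M x <= (sqnorm x)^-1.
  move=> Ox; rewrite lef_pV2 ?posrE ?qpos//; first by rewrite lerDl ltW.
  by rewrite ltr_wpDl// sqnorm_ge0.
have mom M : measurable_fun Omega (om M).
  apply: continuous_measurable_fun_rV => // x.
  have C0' : Ck 0 setT (om M).
    apply: CkV openT _ _.
      by move=> y _; rewrite gt_eqF// ltr_wpDl// sqnorm_ge0.
    by apply: CkD openT _ _; [exact: Ck_sqnorm openT|exact: Ck_cst openT].
  exact: (Ck_continuous C0' (I : setT x)).
have step M : (K%:E * \int[lebN n]_(x in Omega) (v x ^+ 2 * om M x)%:E <=
               C%:E * a%:E + b%:E)%E.
  have jle : (\int[lebN n]_(x in Omega) (v x ^+ 2 * om M x)%:E <= (M.+1%:R * a)%:E)%E.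
    have := @ge0_le_integral_combination Omega (fun x => v x ^+ 2) (fun=> 0)
      (fun x => v x ^+ 2 * om M x) M.+1%:R 0 mO (ler0n _ _) (lexx _) mv2
      (measurable_cst _) (measurable_funM mv2 (mom M)) (fun x => sqr_ge0 _) (fun=> lexx 0).
    rewrite mul0e adde0 -/A AE EFinM; apply=> x Ox.
    by rewrite mulr_ge0 ?sqr_ge0 ?(ltW (om0 _ _))//= mul0r addr0 mulrC ler_wpM2r ?sqr_ge0.
  have jge : (0 <= \int[lebN n]_(x in Omega) (v x ^+ 2 * om M x)%:E)%E.
    by apply: integral_ge0 => x _; rewrite lee_fin mulr_ge0 ?sqr_ge0 ?(ltW (om0 _ _)).
  set J := (\int[lebN n]_(x in Omega) _)%E in jle jge *.
  case Jj : J jge jle => [j| |]//; rewrite !lee_fin => j0 _.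
  pose Z eta := (1 + eta) * (1 + eta^-1) * (C + 1) + K * (1 + eta^-1) * M.+1%:R.
  apply: (@le_of_perturbation _ _ Z); first by rewrite addr_ge0 ?mulr_ge0.
  move=> eta e /andP[eta0 eta1] e0.
  have k0 : 0 < 1 + eta^-1 by rewrite addr_gt0 ?invr_gt0.
  have l0 : 0 < 1 + eta by rewrite addr_gt0.
  have [phi tphi] := Hv e e0; rewrite /H1_sqnorm.
  have mphi : measurable_fun Omega phi.
    by apply: continuous_measurable_fun_rV => //; exact: test_continuous tphi.
  have md : measurable_fun Omega (fun x => (phi x - v x) ^+ 2).
    by apply: L2_measurable_sqr => //; exact: measurable_funB.
  have mdg : measurable_fun Omega (fun x => sqnorm (gradient phi x - g x)).
    apply: measurable_sum => i; apply: L2_measurable_sqr => //.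
    under eq_fun do rewrite !mxE.
    apply: measurable_funB; last by case: (Lg i).
    apply: continuous_measurable_fun_rV => // x.
    exact: (Ck_continuous (Ck_partial i (test_Ck tphi 1)) (I : setT x)).
  set E1 := (\int[lebN n]_(x in Omega) _)%E.
  set E2 := (\int[lebN n]_(x in Omega) _)%E => E12.
  have E10 : (0 <= E1)%E by apply: integral_ge0 => x _; rewrite lee_fin sqr_ge0.
  have E20 : (0 <= E2)%E by apply: integral_ge0 => x _; rewrite lee_fin sqnorm_ge0.
  have E1e : (E1 <= e%:E)%E by rewrite (le_trans _ (ltW E12))// leeDl.
  have E2e : (E2 <= e%:E)%E by rewrite (le_trans _ (ltW E12))// leeDr.
  have Cq := test_quotient_Cc tphi O0; have Cg := test_grad_Cc tphi.
  have Cs := test_sqr_Cc tphi.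
  have hQ := integral_vanish_off mO (test_sub tphi) (@test_quotient_vanish _ _ phi).
  have hA := integral_vanish_off mO (test_sub tphi) (@test_sqr_vanish _ _ phi).
  have hB := integral_vanish_off mO (test_sub tphi) (@test_grad_vanish _ _ phi).
  rewrite integral_Cc// in hQ; rewrite integral_Cc// in hA; rewrite integral_Cc// in hB.
  have := Htest _ tphi; move: hQ hA hB.
  set q := Rintegral _ _ _; set s := Rintegral _ _ _; set gr := Rintegral _ _ _.
  move=> hQ hA hB hK.
  have mCc f : Cc f -> measurable_fun Omega f.
    by move=> [cf _]; exact: continuous_measurable_fun_rV.
  have hj : j <= (1 + eta) * q + (1 + eta^-1) * M.+1%:R * e.
    rewrite -lee_fin -Jj /J EFinD !EFinM -hQ.
    have := @ge0_le_integral_combination Omega (fun x => phi x ^+ 2 / sqnorm x)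
      (fun x => (phi x - v x) ^+ 2) (fun x => v x ^+ 2 * om M x) (1 + eta)
      ((1 + eta^-1) * M.+1%:R) mO (ltW l0) (mulr_ge0 (ltW k0) (ler0n _ _))
      (mCc _ Cq) md (measurable_funM mv2 (mom M)).
    move=> /(_ _ _ _)/le_trans; apply.
    - by move=> x; rewrite divr_ge0 ?sqr_ge0 ?sqnorm_ge0.
    - by move=> x; rewrite sqr_ge0.
    - move=> x Ox; rewrite mulr_ge0 ?sqr_ge0 ?(ltW (om0 _ _))//=.
      apply: (@le_trans _ _ (((1 + eta) * phi x ^+ 2 + (1 + eta^-1) * (phi x - v x) ^+ 2) * om M x)).
        by rewrite ler_wpM2r ?(ltW (om0 _ _))// sqr_split.
      rewrite mulrDl; apply: lerD.
        rewrite -[leLHS]mulrA; apply: ler_wpM2l; first exact: ltW.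
        by apply: ler_wpM2l; [exact: sqr_ge0|exact: omq].
      rewrite -[leLHS]mulrA -[leRHS]mulrA; apply: ler_wpM2l; first exact: ltW.
      by rewrite mulrC; apply: ler_wpM2r; [exact: sqr_ge0|exact: omM].
    - by rewrite leeD2l// EFinM lee_wpmul2l// lee_fin mulr_ge0// ltW.
  have hs : s <= (1 + eta) * a + (1 + eta^-1) * e.
    rewrite -lee_fin EFinD !EFinM -hA -AE /A.
    have := @ge0_le_integral_combination Omega (fun x => v x ^+ 2)
      (fun x => (phi x - v x) ^+ 2) (fun x => phi x ^+ 2) (1 + eta)
      (1 + eta^-1) mO (ltW l0) (ltW k0) mv2 md (mCc _ Cs).
    move=> /(_ _ _ _)/le_trans; apply.
    - by move=> x; rewrite sqr_ge0.
    - by move=> x; rewrite sqr_ge0.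
    - by move=> x Ox; rewrite sqr_ge0/= -[(phi x - v x) ^+ 2]sqrrN opprB sqr_split.
    - by rewrite leeD2l// lee_wpmul2l// lee_fin ltW.
  have hgr : gr <= (1 + eta) * b + (1 + eta^-1) * e.
    rewrite -lee_fin EFinD !EFinM -hB -BE /B.
    have := @ge0_le_integral_combination Omega (fun x => sqnorm (g x))
      (fun x => sqnorm (gradient phi x - g x)) (fun x => sqnorm (gradient phi x)) (1 + eta)
      (1 + eta^-1) mO (ltW l0) (ltW k0) mg2 mdg (mCc _ Cg).
    move=> /(_ _ _ _)/le_trans; apply.
    - by move=> x; rewrite sqnorm_ge0.
    - by move=> x; rewrite sqnorm_ge0.
    - move=> x Ox; rewrite sqnorm_ge0/= -[gradient phi x - g x]opprB.
      have -> : sqnorm (- (g x - gradient phi x)) = sqnorm (g x - gradient phi x).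
        by apply: eq_bigr => i _; rewrite mxE sqrrN.
      exact: sqnorm_split.
    - by rewrite leeD2l// lee_wpmul2l// lee_fin ltW.
  have h1 : K * j <= (1 + eta) * (gr + C * s) + K * (1 + eta^-1) * M.+1%:R * e.
    apply: (le_trans (ler_wpM2l K0 hj)); rewrite mulrDr -!mulrA lerD2r mulrCA.
    by rewrite ler_wpM2l// ltW.
  have h2 : C * s <= C * ((1 + eta) * a + (1 + eta^-1) * e) by rewrite ler_wpM2l.
  have h3 : (1 + eta) * (gr + C * s) <=
    (1 + eta) * ((1 + eta) * b + (1 + eta^-1) * e + C * ((1 + eta) * a + (1 + eta^-1) * e)).
    by rewrite ler_wpM2l ?(ltW l0)// lerD.
  by rewrite /Z; lra.
pose F M x := ((v x ^+ 2 * om M x)%:E : \bar R).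
have mF M : measurable_fun Omega (F M).
  by apply/measurable_EFinP; exact: measurable_funM.
have F0 M x : Omega x -> (0 <= F M x)%E.
  by move=> _; rewrite lee_fin mulr_ge0 ?sqr_ge0// ltW.
have ndF x : Omega x -> {homo F^~ x : M M' / (M <= M')%N >-> (M <= M')%E}.
  move=> Ox M M' MM'; rewrite lee_fin ler_wpM2l ?sqr_ge0// lef_pV2 ?posrE ?ltr_wpDl ?sqnorm_ge0//.
  by rewrite lerD2l lef_pV2 ?posrE ?ltr0n// ler_nat.
have cF : (\int[lebN n]_(x in Omega) F M x)%E @[M --> \oo] -->
    (\int[lebN n]_(x in Omega) (v x ^+ 2 / sqnorm x)%:E)%E.
  have <- : (\int[lebN n]_(x in Omega) limn (fun M => F M x) =
    \int[lebN n]_(x in Omega) (v x ^+ 2 / sqnorm x)%:E)%E.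
    apply: eq_integral => x /[!inE] Ox; apply/cvg_lim => //.
    apply: cvg_EFin; first by near=> M.
    apply: cvgM; first exact: cvg_cst.
    apply: cvgV; first by rewrite gt_eqF// qpos.
    rewrite -[X in _ --> X]addr0; apply: cvgD; first exact: cvg_cst.
    exact: cvg_harmonic.
  exact: (cvg_monotone_convergence mO mF F0 ndF).
have KF : K%:E \is a fin_num by [].
apply: (cvge_le _ (cvgeZl KF cF)).
by apply: nearW => M; exact: step.
Unshelve. all: by end_near.
Qed.
End density.

(** * A subsolution with a smaller constant *)

Section subsolution_inequalities.
Context {R : realType}.

(** The radial factor exp(- L^2 / w) with w = tau (L - tau): in the variable
    z = w / L^2, which ranges over (0, 1/4], the claim is that
    1 - 6 z + 6 z^2 + 64 z^4 >= 0. *)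
Lemma radial_subsolution (L tau w h1 h2 : R) : 0 < L -> 0 < w ->
  w = tau * (L - tau) ->
  h1 = L ^+ 2 * (L - 2 * tau) / w ^+ 2 ->
  h2 = - (2 * L ^+ 2 / w ^+ 2) - 2 * L ^+ 2 * (L - 2 * tau) ^+ 2 / w ^+ 3 ->
  - (256 / L ^+ 2) <= 4 * (h1 ^+ 2 + h2).
Proof.
move=> L0 w0 wD h1D h2D.
pose z := w / L ^+ 2.
have z0 : 0 < z by rewrite divr_gt0// exprn_gt0.
have z4 : 4 * z <= 1.
  rewrite /z mulrA ler_pdivrMr ?exprn_gt0// mul1r wD -subr_ge0.
  have -> : L ^+ 2 - 4 * (tau * (L - tau)) = (L - 2 * tau) ^+ 2 by ring.
  exact: sqr_ge0.
have E : h1 ^+ 2 + h2 = (1 - 6 * z + 6 * z ^+ 2) / (L ^+ 2 * z ^+ 4).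
  have wE : w = L ^+ 2 * z by rewrite /z mulrC divfK// gt_eqF// exprn_gt0.
  have dE : (L - 2 * tau) ^+ 2 = L ^+ 2 * (1 - 4 * z).
    by rewrite mulrBr mulr1 mulrCA -wE wD; ring.
  rewrite h1D h2D exprMn exprVn exprMn dE wE.
  by field; rewrite !gt_eqF.
rewrite E mulrA -subr_ge0 opprK.
have -> : 4 * (1 - 6 * z + 6 * z ^+ 2) / (L ^+ 2 * z ^+ 4) + 256 / L ^+ 2 =
  4 * (1 - 6 * z + 6 * z ^+ 2 + 64 * z ^+ 4) / (L ^+ 2 * z ^+ 4).
  by field; rewrite !gt_eqF.
apply: divr_ge0; last by rewrite mulr_ge0// exprn_ge0 ?(ltW L0) ?(ltW z0).
apply: mulr_ge0 => //.
(* The squares are centred close to the minimizer of the polynomial. *)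
have := sqr_ge0 (z ^+ 2 - 1 / 25); have := sqr_ge0 (z - 1 / 5).
nra.
Qed.

(** The angular factor exp(- 2 / y), where y = x_N / |x| + 9/10: the spherical
    Laplacian of a function g of s = x_N / |x| is (1 - s^2) g'' - m s g', with
    m = N - 1. The factor 9/10 < 1 in front of m is the gain over the
    half-space, and the claim is affine in m, hence splits into the
    positivity of two polynomials in y. *)
Lemma angular_subsolution (m s y : R) : 1 <= m -> 0 < y -> s = y - 9 / 10 ->
  - (9 / 10 * m) <=
  (1 - s ^+ 2) * ((2 / y ^+ 2) ^+ 2 - 4 / y ^+ 3) - m * s * (2 / y ^+ 2).
Proof.
move=> m1 y0 ->; rewrite -subr_ge0.
have -> : (1 - (y - 9 / 10) ^+ 2) * ((2 / y ^+ 2) ^+ 2 - 4 / y ^+ 3) -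
     m * (y - 9 / 10) * (2 / y ^+ 2) - - (9 / 10 * m) =
  ((9 / 10 * y ^+ 4 + 2 * y ^+ 3 - 94 / 10 * y ^+ 2 + 644 / 100 * y + 76 / 100) +
   (m - 1) * (y ^+ 2 * (9 / 10 * y ^+ 2 - 2 * y + 18 / 10))) / y ^+ 4.
  by field; rewrite gt_eqF.
apply: divr_ge0; last by rewrite exprn_ge0// ltW.
apply: addr_ge0; last first.
  rewrite mulr_ge0 ?subr_ge0// mulr_ge0 ?sqr_ge0//.
  have := sqr_ge0 (y - 10 / 9); nra.
(* The polynomial has its minimum on the positive axis close to 13/10. *)
have y2 := sqr_ge0 (y ^+ 2 - 169 / 100).
have y3 := mulr_ge0 (ltW y0) (sqr_ge0 (y - 13 / 10)).
have y4 := sqr_ge0 (y ^+ 2 - 13 / 10 * y).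
have y5 := sqr_ge0 (y - 13 / 10).
nra.
Qed.
End subsolution_inequalities.

(** * The test function *)

Section profile.
Context {R : realType} {n : nat}.
Implicit Types x : 'rV[R]_n.+1.
Variable L : R.
Hypothesis L0 : 0 < L.
Let N : R := n.+1%:R.
Let a : R := (N - 2) / 2.

Definition logsq x : R := ln (sqnorm x).
Definition inv_radius x : R := expR (- 2^-1 * logsq x).
Definition height x : R := vertical x * inv_radius x.
Definition cap x : R := height x + 9 / 10.
Definition window x : R := logsq x * (L - logsq x).

(** Up to its two cutoffs this is |x|^(-(N-2)/2). The factors are supported where
    1 <= |x|^2 <= exp L and where x_N / |x| >= - 9/10. *)
Definition profile x : R :=
  expR (- (a / 2) * logsq x) *
  (flat 0 ((L ^+ 2)^-1 * window x) * flat 0 (2^-1 * cap x)).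

Definition radial1 x := L ^+ 2 * (L - 2 * logsq x) / window x ^+ 2.
Definition radial2 x := - (2 * L ^+ 2 / window x ^+ 2)
  - 2 * L ^+ 2 * (L - 2 * logsq x) ^+ 2 / window x ^+ 3.

(** The next functions are the logarithm of the profile, where it is positive,
    and its partial derivatives of order one and two. *)
Definition log_profile x : R :=
  - (a / 2) * logsq x - L ^+ 2 / window x - 2 / cap x.

Definition height1 (i : 'I_n.+1) x : R :=
  (i == ord_max)%:R * inv_radius x - vertical x * inv_radius x * (x 0 i / sqnorm x).

Definition log_profile1 (i : 'I_n.+1) x : R :=
  (radial1 x - a / 2) * (2 * (x 0 i / sqnorm x)) + 2 / cap x ^+ 2 * height1 i x.

Definition log_profile2 (i : 'I_n.+1) x : R :=
  radial2 x * (2 * (x 0 i / sqnorm x)) ^+ 2 +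
  (radial1 x - a / 2) * (2 * (1 / sqnorm x - 2 * x 0 i ^+ 2 / sqnorm x ^+ 2)) -
  4 / cap x ^+ 3 * height1 i x ^+ 2 +
  2 / cap x ^+ 2 *
   (- (2 * inv_radius x * ((i == ord_max)%:R * x 0 i) / sqnorm x) +
    3 * (vertical x * inv_radius x) * x 0 i ^+ 2 / sqnorm x ^+ 2
    - vertical x * inv_radius x / sqnorm x).

Section at_point.
Variables (i : 'I_n.+1) (x : 'rV[R]_n.+1).
Hypothesis q0 : 0 < sqnorm x.
Local Notation e_i := (delta_mx 0 i : 'rV[R]_n.+1).
Local Notation S_i := ((i == ord_max)%:R : R).

Lemma is_derive_logsq :
  is_derive x e_i (logsq : _ -> R^o) (2 * (x 0 i / sqnorm x)).
Proof.
have := is_derive_log q0 (is_derive_sqnorm i x).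
by apply: is_derive_ext => //; rewrite mulrC -mulrA.
Qed.

Lemma is_derive_ratio :
  is_derive x e_i ((fun y : 'rV[R]_n.+1 => y 0 i / sqnorm y) : _ -> R^o)
    (1 / sqnorm x - 2 * x 0 i ^+ 2 / sqnorm x ^+ 2).
Proof.
have := is_derive_mul (is_derive_coord i i x) (is_derive_inv (lt0r_neq0 q0) (is_derive_sqnorm i x)).
by apply: is_derive_ext => //; rewrite eqxx -[true%:R]/(1 : R); field; rewrite gt_eqF.
Qed.

Lemma is_derive_inv_radius :
  is_derive x e_i (inv_radius : _ -> R^o) (- (inv_radius x * (x 0 i / sqnorm x))).
Proof.
have := is_derive_exp (is_derive_scale (- 2^-1) is_derive_logsq).
by apply: is_derive_ext => //; rewrite -/(inv_radius x); field; rewrite gt_eqF.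
Qed.

Lemma is_derive_height : is_derive x e_i (height : _ -> R^o) (height1 i x).
Proof.
have := is_derive_mul (is_derive_coord i ord_max x) is_derive_inv_radius.
by apply: is_derive_ext => //; rewrite /height1 /vertical; ring.
Qed.

Lemma is_derive_height1 : is_derive x e_i (height1 i : _ -> R^o)
   (- (2 * inv_radius x * (S_i * x 0 i) / sqnorm x) +
    3 * (vertical x * inv_radius x) * x 0 i ^+ 2 / sqnorm x ^+ 2
    - vertical x * inv_radius x / sqnorm x).
Proof.
have D1 := is_derive_scale S_i is_derive_inv_radius.
have D2 := is_derive_scale (-1) (is_derive_mul is_derive_height is_derive_ratio).
have := is_derive_add D1 D2.
apply: is_derive_ext => [y|]; first by rewrite mulN1r.
by rewrite /height1 /height; field; rewrite gt_eqF.
Qed.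

Lemma is_derive_cap : is_derive x e_i (cap : _ -> R^o) (height1 i x).
Proof.
have := is_derive_add is_derive_height (is_derive_cst (9 / 10 : R^o) x e_i).
by apply: is_derive_ext => //; rewrite addr0.
Qed.

Lemma is_derive_window : is_derive x e_i (window : _ -> R^o)
  ((L - 2 * logsq x) * (2 * (x 0 i / sqnorm x))).
Proof.
have D1 := is_derive_add (is_derive_cst (L : R^o) x e_i) (is_derive_scale (-1) is_derive_logsq).
have := is_derive_mul is_derive_logsq D1.
apply: is_derive_ext => [y|]; first by rewrite /= mulN1r.
by rewrite /=; ring.
Qed.

Hypotheses (w0 : 0 < window x) (y0 : 0 < cap x).

Lemma is_derive_log_profile :
  is_derive x e_i (log_profile : _ -> R^o) (log_profile1 i x).
Proof.
have D1 := is_derive_scale (- (a / 2)) is_derive_logsq.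
have D2 := is_derive_scale (- L ^+ 2) (is_derive_inv (lt0r_neq0 w0) is_derive_window).
have D3 := is_derive_scale (- 2) (is_derive_inv (lt0r_neq0 y0) is_derive_cap).
have := is_derive_add (is_derive_add D1 D2) D3.
apply: is_derive_ext => [y|]; first by rewrite /log_profile -!mulNr.
by rewrite /log_profile1 /radial1; field; rewrite !gt_eqF.
Qed.

Lemma is_derive_radial1 :
  is_derive x e_i (radial1 : _ -> R^o) (radial2 x * (2 * (x 0 i / sqnorm x))).
Proof.
have D1 := is_derive_add (is_derive_cst (L : R^o) x e_i) (is_derive_scale (- 2) is_derive_logsq).
have D2 := is_derive_inv (f := fun y => window y ^+ 2) (expf_neq0 2 (lt0r_neq0 w0))
  (is_derive_pow 2 is_derive_window).
have := is_derive_mul (is_derive_scale (L ^+ 2) D1) D2.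
apply: is_derive_ext => [y|]; first by rewrite /= mulNr.
by rewrite /radial2 /=; field; rewrite !gt_eqF.
Qed.

Lemma is_derive_log_profile1 :
  is_derive x e_i (log_profile1 i : _ -> R^o) (log_profile2 i x).
Proof.
have D1 := is_derive_add is_derive_radial1 (is_derive_cst (- (a / 2) : R^o) x e_i).
have D2 := is_derive_mul D1 (is_derive_scale 2 is_derive_ratio).
have D3 := is_derive_inv (f := fun y => cap y ^+ 2) (expf_neq0 2 (lt0r_neq0 y0))
  (is_derive_pow 2 is_derive_cap).
have D4 := is_derive_mul (is_derive_scale 2 D3) is_derive_height1.
have := is_derive_add D2 D4.
apply: is_derive_ext => [//|].
by rewrite /log_profile2 /=; field; rewrite !gt_eqF.
Qed.

Lemma inv_radius_sqr : inv_radius x ^+ 2 = (sqnorm x)^-1.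
Proof.
rewrite /inv_radius /logsq -expRM_natl mulrA mulrN.
rewrite (_ : 2%:R * 2^-1 = 1); last by field.
by rewrite mulN1r expRN lnK.
Qed.

(** Here |x|^2 (Delta v) / v splits into a radial and an angular part, because
    the gradients of log |x|^2 and of x_N / |x| are orthogonal. *)
Lemma sum_log_profile2 :
  \sum_j (log_profile1 j x ^+ 2 + log_profile2 j x) =
  (4 * (radial1 x ^+ 2 + radial2 x) - a ^+ 2 +
   (1 - height x ^+ 2) * ((2 / cap x ^+ 2) ^+ 2 - 4 / cap x ^+ 3) -
   (N - 1) * height x * (2 / cap x ^+ 2)) / sqnorm x.
Proof.
pose q := sqnorm x; pose p := vertical x; pose rho := inv_radius x.
pose f1 := radial1 x - a / 2; pose h2 := radial2 x.
pose g1 := 2 / cap x ^+ 2; pose g2 := 4 / cap x ^+ 3.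
pose al := 2 * f1 / q - g1 * p * rho / q; pose be := g1 * rho.
have rho0 : rho != 0 by rewrite gt_eqF// expR_gt0.
have qE : q = (rho ^+ 2)^-1 by rewrite inv_radius_sqr invrK.
rewrite (eq_bigr (fun j => al + (al ^+ 2 + 4 * h2 / q ^+ 2 - 4 * f1 / q ^+ 2
     - g2 * p ^+ 2 * rho ^+ 2 / q ^+ 2 + 3 * g1 * p * rho / q ^+ 2) * x 0 j ^+ 2
  + (be ^+ 2 - g2 * rho ^+ 2) * (j == ord_max)%:R
  + (2 * al * be + 2 * g2 * p * rho ^+ 2 / q - 2 * g1 * rho / q) *
     ((j == ord_max)%:R * x 0 j))).
  rewrite sum_quadratic -/N -/q -/p -/g1 -/g2 -/h2 /height -/p -/rho /al /be /f1 /a qE.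
  by field; rewrite rho0.
move=> j _; rewrite /log_profile1 /log_profile2 /height1.
rewrite -/q -/p -/rho -/f1 -/h2 -/g1 -/g2 /al /be.
have qn0 : q != 0 by rewrite gt_eqF.
by case: (j == ord_max) => /=; rewrite ?mulr1n ?mulr0n; field; rewrite ?qn0.
Qed.

Lemma sum_log_profile2_ge : 1 <= N - 1 ->
  - (a ^+ 2 + 256 / L ^+ 2 + 9 / 10 * (N - 1)) / sqnorm x <=
  \sum_j (log_profile1 j x ^+ 2 + log_profile2 j x).
Proof.
move=> N1; rewrite sum_log_profile2 ler_pM2r ?invr_gt0//.
have := @radial_subsolution _ L (logsq x) (window x) (radial1 x) (radial2 x) L0 w0 erefl erefl erefl.
have := @angular_subsolution _ (N - 1) (height x) (cap x) N1 y0 _.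
rewrite {1}/cap addrK => /(_ erefl); lra.
Qed.

End at_point.
End profile.

(** * The Rayleigh quotient of the test function *)

Section profile_test.
Context {R : realType} {n : nat}.
Implicit Types x : 'rV[R]_n.+1.
Variable L : R.
Hypothesis L0 : 0 < L.
Let N : R := n.+1%:R.
Let a : R := (N - 2) / 2.
Let v := @profile R n L.

Lemma window_le0 x : sqnorm x <= 1 -> window L x <= 0.
Proof.
move=> q1; have t0 : logsq x <= 0 by exact: ln_le0.
by rewrite /window mulr_le0_ge0// subr_ge0 (le_trans t0)// ltW.
Qed.

Lemma window_gt0 x : 0 < window L x -> 1 < sqnorm x /\ logsq x < L.
Proof.
move=> w0; have q1 : 1 < sqnorm x by rewrite ltNge; apply/negP => /window_le0; rewrite leNgt w0.
split => //; have t0 : 0 < logsq x by exact: ln_gt0.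
by move: w0; rewrite /window pmulr_rgt0// subr_gt0.
Qed.

Lemma profile_neq0 x : v x != 0 -> 0 < window L x /\ 0 < cap x.
Proof.
rewrite /v /profile !mulf_eq0 !negb_or => /and3P[_ wn yn]; split.
  by rewrite ltNge; apply: contra wn => w0; rewrite flat_le0// mulr_ge0_le0// invr_ge0 exprn_ge0// ltW.
by rewrite ltNge; apply: contra yn => y0; rewrite flat_le0// mulr_ge0_le0.
Qed.

Lemma profileE x : 0 < window L x -> 0 < cap x -> v x = expR (log_profile L x).
Proof.
move=> w0 y0.
have h1 : 0 < (L ^+ 2)^-1 * window L x by rewrite mulr_gt0// invr_gt0 exprn_gt0.
have h2 : 0 < 2^-1 * cap x by rewrite mulr_gt0.
rewrite /v /profile /log_profile (flatE 0 h1) (flatE 0 h2).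
by rewrite !expr0 !mul1r !invfM !invrK !expRD mulrA.
Qed.

Lemma Ck_logsq k (U : set 'rV[R]_n.+1) : open U -> (forall x, U x -> 0 < sqnorm x) ->
  Ck k U logsq.
Proof. by move=> oU q0; apply: Ck_log => //; exact: Ck_sqnorm. Qed.

Lemma Ck_cap k (U : set 'rV[R]_n.+1) : open U -> (forall x, U x -> 0 < sqnorm x) ->
  Ck k U cap.
Proof.
move=> oU q0; apply: CkD => //; last exact: Ck_cst.
apply: CkM => //; first exact: Ck_coord.
by apply: Ck_exp => //; apply: CkZ => //; exact: Ck_logsq.
Qed.

Lemma Ck_window k (U : set 'rV[R]_n.+1) : open U -> (forall x, U x -> 0 < sqnorm x) ->
  Ck k U (window L).
Proof.
move=> oU q0; apply: CkM => //; first exact: Ck_logsq.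
under eq_fun do rewrite -mulN1r.
by apply: CkD => //; [exact: Ck_cst|apply: CkZ => //; exact: Ck_logsq].
Qed.

Lemma smooth_profile : smooth_on setT v.
Proof.
move=> k; pose U : set 'rV[R]_n.+1 := [set x | 0 < sqnorm x].
have -> : setT = U `|` [set x : 'rV[R]_n.+1 | sqnorm x < 1].
  apply/seteqP; split => // x _.
  by have [q0|q0] := ltP 0 (sqnorm x); [left|right; exact: le_lt_trans q0 _].
have oU : open U by exact: open_sqnorm_gt.
apply: CkU.
  apply: CkM => //.
    by apply: Ck_exp => //; apply: CkZ => //; exact: Ck_logsq.
  by apply: CkM => //; apply: Ck_flat => //; apply: CkZ => //; [exact: Ck_window|exact: Ck_cap].
have o1 := @open_sqnorm_lt R n.+1 1.
apply: (Ck_eq (f := fun=> 0)) (Ck_cst _ _ o1) => // x /= q1.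
apply/esym/eqP; apply: contraT => /profile_neq0[/window_gt0[+ _] _].
by move=> /(lt_trans q1); rewrite ltxx.
Qed.

Lemma near_profile_pos x : 0 < window L x -> 0 < cap x ->
  \near x, 0 < window L x /\ 0 < cap x.
Proof.
move=> w0 y0; have [q1 _] := window_gt0 w0.
have q0 : 0 < sqnorm x by rewrite (lt_trans _ q1).
have oU : open [set x : 'rV[R]_n.+1 | 0 < sqnorm x] by exact: open_sqnorm_gt.
have cw := Ck_continuous (Ck_window 0 oU (fun _ h => h)) q0.
have cc := Ck_continuous (Ck_cap 0 oU (fun _ h => h)) q0.
near=> z; split; near: z.
  exact: (cvgr_gt (window L x) cw).
exact: (cvgr_gt (cap x) cc).
Unshelve. all: by end_near. Qed.

Lemma is_derive_profile i x : 0 < window L x -> 0 < cap x ->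
  is_derive x (delta_mx 0 i) (v : _ -> R^o) (v x * log_profile1 L i x).
Proof.
move=> w0 y0; have [q1 _] := window_gt0 w0.
have q0 : 0 < sqnorm x by rewrite (lt_trans _ q1).
apply: (@near_eq_is_derive _ _ R^o (fun x => expR (log_profile L x))).
  apply: filterS (near_profile_pos w0 y0) => z [wz yz].
  by rewrite profileE.
rewrite profileE//; apply: is_derive_exp.
exact: is_derive_log_profile.
Qed.

Lemma partial2_profile i x : 0 < window L x -> 0 < cap x ->
  partial i (partial i v) x = v x * (log_profile1 L i x ^+ 2 + log_profile2 L i x).
Proof.
move=> w0 y0; have [q1 _] := window_gt0 w0.
have q0 : 0 < sqnorm x by rewrite (lt_trans _ q1).
apply: partial_is_derive.
apply: (@near_eq_is_derive _ _ R^o (fun x => v x * log_profile1 L i x)).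
  apply: filterS (near_profile_pos w0 y0) => z [wz yz].
  by apply/esym/partial_is_derive; exact: is_derive_profile.
apply: (is_derive_eq (is_derive_mul (is_derive_profile i w0 y0) (is_derive_log_profile1 i q0 w0 y0))).
by ring.
Qed.

Lemma partial_sqr_profile i x :
  partial i (fun y => v y * partial i v y) x =
  partial i v x ^+ 2 + v x * partial i (partial i v) x.
Proof.
apply: partial_is_derive; have C2 := smooth_profile 2.
have D1 := Ck_derive i (smooth_profile 1) (I : setT x).
have D2 := Ck_derive i (Ck_partial i C2) (I : setT x).
exact: is_derive_mul D1 D2.
Qed.

Definition rayleigh : R := a ^+ 2 + 256 / L ^+ 2 + 9 / 10 * (N - 1).

Lemma divergence_profile_ge x : 1 <= N - 1 ->
  sqnorm (gradient v x) <=
  \sum_i partial i (fun y => v y * partial i v y) x + rayleigh * (v x ^+ 2 / sqnorm x).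
Proof.
move=> N1; under eq_bigr do rewrite partial_sqr_profile.
rewrite big_split /= -addrA.
rewrite (_ : sqnorm (gradient v x) = \sum_i partial i v x ^+ 2); last first.
  by apply: eq_bigr => i _; rewrite mxE.
rewrite lerDl; have [vx|vx] := eqVneq (v x) 0.
  rewrite vx expr0n mul0r mulr0 addr0 big1// => i _.
  by rewrite mul0r.
have [w0 y0] := profile_neq0 vx; have [q1 _] := window_gt0 w0.
have q0 : 0 < sqnorm x by rewrite (lt_trans _ q1).
under eq_bigr do rewrite partial2_profile// mulrA -expr2.
rewrite -mulr_sumr mulrCA -mulrDr mulr_ge0 ?sqr_ge0//.
have := sum_log_profile2_ge L0 q0 w0 y0 N1.
rewrite -/a -/rayleigh mulNr -subr_ge0 opprK; apply.
Qed.

(** The third condition is x_N / |x| >= - 9/10 in polynomial form. *)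
Definition support_bound : set 'rV[R]_n.+1 :=
  [set x | 1 <= sqnorm x] `&` [set x | sqnorm x <= expR L] `&`
  ([set x | 0 <= vertical x] `|` [set x | vertical x ^+ 2 <= 81 / 100 * sqnorm x]).

Lemma profile_support : closure [set x | v x != 0] `<=` support_bound.
Proof.
have cq (A : set R) : closed A -> closed (@sqnorm R n.+1 @^-1` A).
  by move=> cA; apply: closed_comp => // x _; exact: continuous_sqnorm.
have cv : continuous (@vertical R n) by exact: continuous_coord.
have cS : closed support_bound.
  apply: closedI; first by apply: closedI; [exact: (cq _ (@closed_ge R 1))|exact: (cq _ (@closed_le R (expR L)))].
  apply: closedU.
    by apply: (@closed_comp _ _ (@vertical R n) [set t | 0 <= t]) => [x _|]; [exact: cv|exact: closed_ge].
  rewrite (_ : [set _ | _] = (fun x => 81 / 100 * sqnorm x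
    + - 1 * (vertical x * vertical x)) @^-1` [set t | 0 <= t]).
    apply: closed_comp => [x _|]; last exact: closed_ge.
    have C0 : Ck 0 setT (fun x : 'rV[R]_n.+1 => 81 / 100 * sqnorm x + - 1 * (vertical x * vertical x)).
      apply: CkD openT _ _; apply: CkZ openT _; first exact: Ck_sqnorm openT.
      by apply: CkM openT _ _; exact: Ck_coord openT.
    exact: (Ck_continuous C0 (I : setT x)).
  by apply/seteqP; split => x /=; rewrite mulN1r subr_ge0 expr2.
rewrite [X in _ `<=` X](closure_id _).1//; apply: closureS => x /= vx.
have [w0 y0] := profile_neq0 vx; have [q1 tL] := window_gt0 w0.
have q0 : 0 < sqnorm x by rewrite (lt_trans _ q1).
split; first split => /=; first exact: ltW.
  by rewrite -[leLHS]lnK// ler_expR ltW.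
have [s0|s0] := leP 0 (vertical x); first by left.
right => /=; move: y0; rewrite /cap /height => y0.
have r0 : 0 < inv_radius x by exact: expR_gt0.
have : (vertical x * inv_radius x) ^+ 2 <= 81 / 100.
  have : vertical x * inv_radius x <= 0 by rewrite mulr_le0_ge0// ltW.
  nra.
by rewrite exprMn inv_radius_sqr// ler_pdivrMr.
Qed.

(** Here 5 is chosen so that 5 (1 - (9/10)^2) > 9/10. *)
Lemma support_bound_paraboloid : support_bound `<=` paraboloid (- 5).
Proof.
move=> x [[q1 _] sx]; rewrite /paraboloid /= sqnorm_tangential.
rewrite /= in q1; have sq : vertical x ^+ 2 <= sqnorm x by exact: sqr_coord_le_sqnorm.
have [s0|s0] := ltP 0 (vertical x); first by nra.
have : vertical x ^+ 2 <= 81 / 100 * sqnorm x.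
  case: sx => //= s1; have -> : vertical x = 0 by apply/eqP; rewrite eq_le s0.
  by rewrite expr0n mulr_ge0// sqnorm_ge0.
nra.
Qed.

Lemma compact_support_bound (A : set 'rV[R]_n.+1) : closed A ->
  A `<=` support_bound -> compact A.
Proof.
move=> cA AS; apply: bounded_closed_compact => //.
exists (1 + expR L); split; first exact: num_real.
move=> M LM x /AS[[_ /= qL] _]; have e0 := expR_gt0 L.
apply: norm_le_coord => [|i]; first by rewrite (le_trans _ (ltW LM))// addr_ge0// ltW.
apply: le_trans (ltW LM); rewrite -(@ler_pXn2r _ 2) ?nnegrE ?addr_ge0 ?(ltW e0)//.
rewrite real_normK ?num_real// (le_trans (sqr_coord_le_sqnorm _ _))//.
by rewrite (le_trans qL)//; nra.
Qed.

Lemma test_profile : test_function (paraboloid (- 5)) v.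
Proof.
split; first exact: smooth_profile.
- by apply: compact_support_bound profile_support; exact: closed_closure.
- exact: subset_trans profile_support support_bound_paraboloid.
Qed.

(** Integrating |grad v|^2 = div (v grad v) - v Delta v. *)
Lemma profile_rayleigh : 1 <= N - 1 ->
  \int[lebN n.+1]_x sqnorm (gradient v x) <=
  rayleigh * \int[lebN n.+1]_x (v x ^+ 2 / sqnorm x).
Proof.
move=> N1; have tv := test_profile.
have bv : bounded_support v by exact: vanish_off_bounded (test_compact tv) (@test_vanish _ _ v).
have Cw i : Ck 1 setT (fun y => v y * partial i v y).
  by apply: CkM openT _ _; [exact: smooth_profile|exact: Ck_partial (smooth_profile 2)].
have bw i : bounded_support (fun y => v y * partial i v y).
  by have [M vM] := bv; exists M => x /vM ->; rewrite mul0r.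
have [Cd Id] := Rintegral_divergence_eq0 id Cw bw.
have n0 := @not_paraboloid0 R n (- 5).
have Cq := test_quotient_Cc tv n0; have Cg := test_grad_Cc tv.
rewrite -Rintegral_CcZ// -[leRHS]add0r -Id -Rintegral_CcD//; last exact: CcZ.
apply: le_Rintegral_Cc => //; first by apply: CcD => //; exact: CcZ.
by move=> x; exact: divergence_profile_ge.
Qed.

End profile_test.

(** * The paraboloid is a hyperbolic domain *)

Section paraboloid_domain.
Context {R : realType} {n : nat}.
Variable gamma : R.
Hypothesis gamma0 : gamma < 0.
Let Omega := @paraboloid R n gamma.

Let defect (x : 'rV[R]_n.+1) := vertical x - gamma * (sqnorm x - vertical x ^+ 2).

Let defect_continuous : continuous defect.
Proof.
have C0 : Ck 0 setT (fun x : 'rV[R]_n.+1 =>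
    vertical x + - gamma * (sqnorm x + -1 * (vertical x * vertical x))).
  have Cv : Ck 0 setT (@vertical R n) by exact: Ck_coord openT.
  apply: (CkD openT Cv); apply: CkZ openT _; apply: CkD openT _ _; first exact: Ck_sqnorm openT.
  by apply: CkZ openT _; exact: (CkM openT Cv Cv).
rewrite (_ : defect = fun x => vertical x + - gamma * (sqnorm x + -1 * (vertical x * vertical x))).
  by move=> x; exact: (Ck_continuous C0 (I : setT x)).
by apply/funext => x; rewrite /defect; ring.
Qed.

Let OmegaE : Omega = defect @^-1` [set t | 0 < t].
Proof. by apply/seteqP; split => x /paraboloidE. Qed.

Lemma open_paraboloid : open Omega.
Proof. by rewrite OmegaE; apply: open_comp => [x _|]; [exact: defect_continuous|exact: open_gt]. Qed.

Lemma frontier_paraboloid p : frontier Omega p ->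
  vertical p = gamma * sqnorm (tangential p).
Proof.
move=> [cp ip]; rewrite sqnorm_tangential; apply/eqP; rewrite -subr_eq0 eq_le -/(defect p).
apply/andP; split.
  rewrite leNgt; apply/negP => d0; apply: ip.
  by apply: open_nbhs_nbhs; split; [exact: open_paraboloid|rewrite OmegaE].
have cd : closed (defect @^-1` [set t | 0 <= t]).
  by apply: closed_comp => [x _|]; [exact: defect_continuous|exact: closed_ge].
suff : (defect @^-1` [set t | 0 <= t]) p by [].
rewrite ((closure_id _).1 cd); apply: closureS cp.
by rewrite OmegaE => x /ltW.
Qed.

Let e_N : 'rV[R]_n.+1 := delta_mx 0 ord_max.

Lemma vertical_scale_add (x : 'rV[R]_n.+1) t : vertical (x + t *: e_N) = vertical x + t.
Proof. by rewrite /vertical !mxE !eqxx mulr1. Qed.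

Lemma tangential_scale_add (x : 'rV[R]_n.+1) t : tangential (x + t *: e_N) = tangential x.
Proof.
apply/rowP => i; rewrite !mxE eqxx /= [_ == ord_max]eq_sym (negbTE (neq_lift _ _)).
by rewrite mulr0 addr0.
Qed.

Let shear (x : 'rV[R]_n.+1) := x + (gamma * sqnorm (tangential x)) *: e_N.

Let shear_continuous : continuous shear.
Proof.
have C0 : Ck 0 setT (fun x : 'rV[R]_n.+1 => gamma * sqnorm (tangential x)).
  under eq_fun do rewrite sqnorm_tangential expr2 -mulN1r.
  apply: CkZ openT _; apply: CkD openT _ _; first exact: Ck_sqnorm openT.
  by apply: CkZ openT _; apply: CkM openT _ _; exact: Ck_coord openT.
move=> x.
exact: (cvgD (cvg_id : id y @[y --> x] --> x) (cvgZr_tmp (Ck_continuous C0 (I : setT x)))).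
Qed.

(** The shear maps the half-space onto the paraboloid, and the segments issued
    from e_N cover the half-space. *)
Lemma connected_paraboloid : connected Omega.
Proof.
pose seg (y : 'rV[R]_n.+1) (t : R) := shear (e_N + t *: (y - e_N)).
have -> : Omega = \bigcup_(y in [set y | 0 < vertical y]) (seg y @` `[0, 1]).
  apply/seteqP; split => [x Ox|x [y y0 [t /= t01 <-]]].
    exists (x - (gamma * sqnorm (tangential x)) *: e_N).
      by rewrite /= -scaleNr vertical_scale_add subr_gt0.
    exists 1; first by rewrite /= in_itv/= ler01 lexx.
    rewrite /seg scale1r addrC subrK /shear -scaleNr tangential_scale_add scaleNr.
    by rewrite subrK.
  rewrite /Omega /paraboloid /= /seg /shear tangential_scale_add vertical_scale_add.
  rewrite ltrDr; move: y0 t01 => /= y0; rewrite in_itv/= => /andP[t0 t1].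
  have -> : vertical (e_N + t *: (y - e_N)) = (1 - t) + t * vertical y.
    by rewrite /vertical !mxE !eqxx /= ?mulr1n; ring.
  have [->|tn1] := eqVneq t 1; first by rewrite subrr add0r mul1r.
  by rewrite ltr_pwDl ?subr_gt0 ?lt_neqAle ?tn1// mulr_ge0// ltW.
apply: bigcup_connected.
  exists (shear e_N) => y y0; exists 0; first by rewrite /= in_itv/= lexx ler01.
  by rewrite /seg scale0r addr0.
move=> y _; apply: connected_continuous_connected; first exact: segment_connected.
apply: continuous_subspaceT => t; apply: continuous_comp; last exact: shear_continuous.
exact: (cvgD (cvg_cst e_N) (cvgZr_tmp (cvg_id : id s @[s --> t] --> t))).
Qed.

Lemma paraboloid_axis t : 0 < t -> Omega (t *: e_N).
Proof.
move=> t0; rewrite /Omega /paraboloid /= -[_ *: _]add0r.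
rewrite tangential_scale_add vertical_scale_add /vertical mxE add0r.
by rewrite /sqnorm big1 ?mulr0// => i _; rewrite !mxE expr0n.
Qed.

Lemma domain_paraboloid : domain Omega.
Proof.
split; [exact: open_paraboloid|exact: connected_paraboloid|exists (1 *: e_N)].
exact: paraboloid_axis.
Qed.

Lemma frontier_paraboloid0 : frontier Omega 0.
Proof.
split; last by move=> /interior_subset; exact: not_paraboloid0.
move=> A /nbhs_ballP[e /= e0 eA]; exists ((e / 2) *: e_N); split.
  by apply: paraboloid_axis; rewrite divr_gt0.
apply: eA; split => // i j; rewrite !mxE /ball /= sub0r normrN.
rewrite normrM ger0_norm ?divr_ge0 ?ltW//.
have h : `|((i == 0) && (j == ord_max))%:R| <= 1 :> R.
  by case: (_ && _); rewrite ?normr1 ?normr0.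
apply: (@le_lt_trans _ _ (e / 2)); last by rewrite ltr_pdivrMr// ltr_pMr// ltr1n.
by rewrite ler_piMr// divr_ge0// ltW.
Qed.

Lemma smooth_boundary_paraboloid : smooth_boundary_at0 Omega.
Proof.
exists 1%:M, (fun y => gamma * sqnorm y), setT, (fun=> gamma); split.
- by split; [rewrite trmx1 mulmx1|exact: det1].
- by apply/nbhs_ballP; exists 1 => //= x _; rewrite subr0 mulmx1.
- split; first by split => //; exact: openT.
  by move=> k; apply: CkZ openT _; exact: Ck_sqnorm openT.
- move=> e e0; apply/nbhs_ballP; exists 1 => //= y _; rewrite -mulr_sumr subrr normr0.
  by rewrite mulr_ge0 ?sqnorm_ge0// ltW.
Qed.

Let clamp (t : R) := Num.max (-1) (Num.min 1 t).

Let clamp_id t : `|t| < 1 -> clamp t = t.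
Proof.
rewrite ltr_norml => /andP[t1 t2]; rewrite /clamp min_r ?max_r// ltW//.
Qed.

Let clamp_bound t : `|clamp t| <= 1.
Proof.
rewrite /clamp ler_norml le_max lexx /= ge_max ge_min lexx orTb andbT.
lra.
Qed.

Let clamp_lipschitz s t : `|clamp s - clamp t| <= `|s - t|.
Proof.
wlog st : s t / s <= t => [H|].
  by have [/H//|/ltW/H] := leP s t; rewrite distrC [leRHS]distrC.
rewrite distrC [leRHS]distrC [leRHS]ger0_norm ?subr_ge0// /clamp.
have [s1|s1] := leP 1 s; have [t1|t1] := leP 1 t; rewrite ler_norml.
- by rewrite subrr; lra.
- by lra.
- by have [h|h] := leP (-1) s; rewrite max_r; lra.
- by have [h|h] := leP (-1) s; have [h'|h'] := leP (-1) t; lra.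
Qed.

(** The quadratic graph function is only locally Lipschitz; as the
    description of the boundary is local, its argument may be clamped to the
    unit cube. *)
Lemma lipschitz_paraboloid : lipschitz_boundary Omega.
Proof.
move=> p fp; pose p' := tangential p.
exists 1%:M, (fun y => gamma * \sum_(i < n) (clamp (y 0 i) ^+ 2 + 2 * p' 0 i * clamp (y 0 i))).
split.
- by split; [rewrite trmx1 mulmx1|exact: det1].
- pose k := `|gamma| * \sum_(i < n) (2 + 2 * `|p' 0 i|).
  have PF : ProperFilter (globally ([set: 'rV[R]_n] `*` [set: 'rV[R]_n])).
    exact: (@globally_properfilter _ _ ((0, 0) : 'rV[R]_n * 'rV[R]_n)).
  apply: (@klipschitzW _ _ _ k _ _ PF); rewrite /dominated_by /globally /= => -[y z] _ /=.
  rewrite -mulrBr normrM -sumrB -mulrA ler_wpM2l// mulr_suml.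
  apply: le_trans (ler_norm_sum _ _ _) _; apply: ler_sum => i _.
  set cy := clamp (y 0 i); set cz := clamp (z 0 i).
  have -> : cy ^+ 2 + 2 * p' 0 i * cy - (cz ^+ 2 + 2 * p' 0 i * cz) =
    (cy + cz + 2 * p' 0 i) * (cy - cz) by ring.
  rewrite normrM; apply: ler_pM => //.
    apply: le_trans (ler_normD _ _) _; rewrite normrM ger0_norm// lerD2r.
    apply: le_trans (ler_normD _ _) _.
    by have := clamp_bound (y 0 i); have := clamp_bound (z 0 i); rewrite -/cy -/cz; lra.
  apply: le_trans (clamp_lipschitz _ _) _.
  by have := coord_le_norm (y - z) i; rewrite !mxE.
- apply/nbhs_ballP; exists 1 => //= x xp; rewrite mulmx1.
  have clE i : clamp (tangential (x - p) 0 i) = tangential x 0 i - p' 0 i.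
    rewrite /p' !mxE clamp_id//.
    by case: xp => _ /(_ 0 (lift ord_max i)); rewrite /ball /= distrC.
  have -> : vertical (x - p) = vertical x - vertical p by rewrite /vertical !mxE.
  have -> : \sum_(i < n) (clamp (tangential (x - p) 0 i) ^+ 2 +
      2 * p' 0 i * clamp (tangential (x - p) 0 i)) = sqnorm (tangential x) - sqnorm p'.
    rewrite /sqnorm -sumrB; apply: eq_bigr => i _; rewrite clE; ring.
  by rewrite (frontier_paraboloid fp) mulrBr ltrD2r.
Qed.

Lemma hyperbolic_paraboloid : hyperbolic_domain Omega.
Proof.
split; [exact: domain_paraboloid|exact: lipschitz_paraboloid| |by exists gamma].
by split; [exact: frontier_paraboloid0|exact: smooth_boundary_paraboloid].
Qed.

End paraboloid_domain.

(** * Proof of the theorem *)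

Section positivity.
Context {R : realType} {n : nat}.

Lemma Rintegral_Cc_gt0 (f : 'rV[R]_n -> R) x0 : Cc f -> (forall x, 0 <= f x) ->
  0 < f x0 -> 0 < \int[lebN n]_x f x.
Proof.
move=> Cf f0 fx0; have [cf _] := Cf.
have /nbhs_ballP[e /= e0 eA] : nbhs x0 [set x | f x0 / 2 < f x].
  apply: (cvgr_gt (f x0) (cf x0)).
  by rewrite ltr_pdivrMr// ltr_pMr// ltr1n.
pose I (i : 'I_n) : set R := `]x0 0 i - e, x0 0 i + e[%classic.
pose A : set 'rV[R]_n := [set x | forall i, I i (x 0 i)].
have mI i : measurable (I i) by exact: measurable_itv.
have mA : measurable A by exact: measurable_box.
have A0 : (0 < lebN n A)%E.
  have -> : lebN n A = _ := lebN_box mI.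
  apply: (big_ind (fun x => 0 < x)%E) => //; first by move=> x y; exact: mule_gt0.
  move=> i _; rewrite lebesgue_measure_itv /= lte_fin.
  have h : x0 0 i - e < x0 0 i + e by lra.
  by rewrite h -EFinB lte_fin subr_gt0.
have Af x : A x -> f x0 / 2 <= f x.
  move=> Ax; apply/ltW/eA; split => // j i; rewrite ord1 /ball /= ltr_distlC.
  by have := Ax i; rewrite /I /= in_itv.
have mf : measurable_fun setT (EFin \o f).
  by apply/measurable_EFinP; exact: continuous_measurable_fun_rV.
rewrite -lte_fin -integral_Cc//.
apply: (@lt_le_trans _ _ (\int[lebN n]_(x in A) (f x)%:E)%E); last first.
  by apply: ge0_subset_integral => // x _; rewrite lee_fin.
apply: (@lt_le_trans _ _ (\int[lebN n]_(x in A) (f x0 / 2)%:E)%E); last first.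
  apply: ge0_le_integral => //.
  - by move=> x _; rewrite lee_fin divr_ge0.
  - exact: measurable_funTS.
rewrite integral_cst//; apply: mule_gt0 => //.
by rewrite lte_fin divr_gt0.
Qed.

Lemma test_H10 (Omega : set 'rV[R]_n) (v : 'rV[R]_n -> R) : open Omega ->
  test_function Omega v -> H10 Omega v (gradient v).
Proof.
move=> oO tv; have mO := open_measurable_rV oO.
have Cv : Cc v by exact: (vanish_Cc tv (@test_continuous _ _ _ _ tv) (@test_vanish _ _ v)).
have sqr_fin f : Cc f -> vanish_off (closure [set x | v x != 0]) f -> L2 Omega f.
  move=> [cf bf] fS; split; first exact: continuous_measurable_fun_rV.
  have C2 : Cc (fun x => f x ^+ 2) by exact: CcM.
  rewrite (integral_vanish_off mO (test_sub tv)); last by move=> x /fS ->; rewrite expr0n.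
  by rewrite integral_Cc// ltry.
have Cp i : Cc (partial i v).
  by case: Cv => _ bv; exact: partial_Cc (test_Ck tv 1) bv.
split; last first.
  move=> e e0; exists v => //; rewrite /H1_sqnorm.
  rewrite !integral0_eq ?adde0 ?lte_fin// => x _; last by rewrite subrr expr0n.
  by rewrite subrr /sqnorm big1// => i _; rewrite mxE expr0n.
split.
- by apply: sqr_fin Cv (@test_vanish _ _ v).
- move=> i; rewrite (_ : (fun x => _) = partial i v); last by apply/funext => x; rewrite mxE.
  by apply: sqr_fin (Cp i) (@test_partial_vanish _ _ v i).
- move=> i phi tphi.
  have Cphi : Cc phi by exact: (vanish_Cc tphi (@test_continuous _ _ _ _ tphi) (@test_vanish _ _ phi)).
  have Cpphi : Cc (partial i phi).
    by case: Cphi => _ bphi; exact: partial_Cc (test_Ck tphi 1) bphi.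
  under [X in _ = (- X)%E]eq_integral do rewrite mxE.
  rewrite !(integral_vanish_off mO (test_sub tv)).
  + rewrite !integral_Cc; try exact: CcM.
    rewrite -EFinN; congr (_%:E); apply/eqP; rewrite -addr_eq0 -Rintegral_CcD; try exact: CcM.
    have C1 : Ck 1 setT (fun x => v x * phi x).
      by apply: CkM openT _ _; [exact: test_Ck tv 1|exact: test_Ck tphi 1].
    have bvp : bounded_support (fun x => v x * phi x) by case: (CcM Cv Cphi).
    rewrite -[X in _ == X](Rintegral_partial_eq0 i C1 bvp); apply/eqP.
    congr (Rintegral _ _ _); apply/funext => x; apply/esym/partial_is_derive.
    have Dv := Ck_derive i (test_Ck tv 1) (I : setT x).
    have Dp := Ck_derive i (test_Ck tphi 1) (I : setT x).
    by apply: (is_derive_eq (is_derive_mul Dv Dp)); rewrite addrC.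
  + by move=> x /test_partial_vanish ->; rewrite mul0r.
  + by move=> x /test_vanish ->; rewrite mul0r.
Qed.

End positivity.

Section conclusion.
Context {R : realType} {n : nat}.

Lemma hardy_hyperbolic (Omega : set 'rV[R]_n.+1) (gamma eps : R) :
  open Omega -> gamma < 0 -> Omega `<=` paraboloid gamma -> 0 < eps ->
  exists C : R, hardy_inequality Omega C (n.+1%:R ^+ 2 / 4 - eps).
Proof.
move=> oO g0 sub e0.
have [K0|K0] := leP 0 ((n.+1%:R : R) ^+ 2 / 4 - eps).
  exists (@hardy_remainder R n gamma eps); apply: hardy_by_density => //.
  - by move=> /sub; exact: not_paraboloid0.
  - rewrite /hardy_remainder divr_ge0 ?sqr_ge0// addr_ge0 ?mulr_ge0//.
  - by move=> phi tphi; exact: (hardy_test_Rintegral g0 e0 oO sub K0 tphi).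
exists 0 => v g _; rewrite mul0e add0e.
apply: (@le_trans _ _ 0%E).
  apply: mule_le0_ge0; first by rewrite lee_fin ltW.
  by apply: integral_ge0 => x _; rewrite lee_fin divr_ge0 ?sqr_ge0 ?sqnorm_ge0.
by apply: integral_ge0 => x _; rewrite lee_fin sqnorm_ge0.
Qed.

Lemma profile_axis_neq0 (L : R) : 0 < L ->
  @profile R n L (expR (L / 4) *: delta_mx 0 ord_max) != 0.
Proof.
move=> L0; set x := _ *: _.
have vx : vertical x = expR (L / 4) by rewrite /vertical /x !mxE !eqxx mulr1.
have qx : sqnorm x = expR (L / 2).
  have := sqnorm_tangential x; rewrite vx.
  have -> : tangential x = tangential (0 : 'rV[R]_n.+1).
    by rewrite /x -[_ *: _]add0r tangential_scale_add.
  rewrite {1}/sqnorm big1 => [|i _]; last by rewrite !mxE expr0n.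
  move/esym/subr0_eq => ->; rewrite -expRM_natl; congr expR; by field.
have tx : logsq x = L / 2 by rewrite /logsq qx expRK.
have w0 : 0 < window L x.
  rewrite /window tx mulr_gt0 ?divr_gt0// subr_gt0 ltr_pdivrMr// ltr_pMr// ltr1n.
  by [].
have y0 : 0 < cap x.
  by rewrite /cap /height vx addr_gt0// mulr_gt0 ?expR_gt0.
by rewrite profileE// gt_eqF// expR_gt0.
Qed.

Lemma rayleigh_lt (L eps : R) : (1 <= n)%N -> L = 100 ->
  eps < n%:R / 10 - 256 / 10000 ->
  @rayleigh R n L < n.+1%:R ^+ 2 / 4 - eps.
Proof.
move=> n1 -> he; rewrite /rayleigh -natr1.
have -> : (n%:R + 1 - 2) / 2 = ((n%:R - 1) / 2 : R) by field.
have n1' : (1 : R) <= n%:R by rewrite ler1n.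
move: he n1'; move: (n%:R : R) => m; lra.
Qed.

Lemma hardy_fails (eps : R) : (1 <= n)%N -> eps < n%:R / 10 - 256 / 10000 ->
  ~ hardy_inequality (@paraboloid R n (- 5)) 0 (n.+1%:R ^+ 2 / 4 - eps).
Proof.
move=> n1 he H; pose L : R := 100.
have L0 : 0 < L by [].
have tv := @test_profile R n L L0; set v := profile _ in tv.
have := H v _ (test_H10 (@open_paraboloid R n (- 5)) tv).
have Cq := test_quotient_Cc tv (@not_paraboloid0 R n (- 5)); have Cg := test_grad_Cc tv.
have mO := open_measurable_rV (@open_paraboloid R n (- 5)).
rewrite mul0e add0e.
rewrite (integral_vanish_off mO (test_sub tv) (@test_quotient_vanish _ _ v)).
rewrite (integral_vanish_off mO (test_sub tv) (@test_grad_vanish _ _ v)).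
rewrite !integral_Cc// -EFinM lee_fin; apply/negP; rewrite -ltNge.
have N1 : (1 : R) <= n.+1%:R - 1 by rewrite -natr1 addrK ler1n.
apply: (le_lt_trans (profile_rayleigh L0 N1)).
rewrite ltr_pM2r; first exact: rayleigh_lt.
apply: (Rintegral_Cc_gt0 (x0 := expR (L / 4) *: delta_mx 0 ord_max)) => //.
  by move=> x; rewrite divr_ge0 ?sqr_ge0 ?sqnorm_ge0.
have v0 := @profile_axis_neq0 L L0.
apply: divr_gt0; first by rewrite lt_def sqr_ge0 andbT expf_neq0.
apply: sqnorm_gt0; apply/eqP => x0.
move: v0; rewrite -/v x0 (test_vanish (v := v)) ?eqxx// => /(test_sub tv).
exact: not_paraboloid0.
Qed.

End conclusion.

Theorem theorem2p4 (R : realType) (n : nat) (hN : (2 <= n.+1)%N) :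
  (forall Omega : set 'rV[R]_n.+1, hyperbolic_domain Omega ->
   forall eps : R, 0 < eps ->
   exists C : R, hardy_inequality Omega C (n.+1%:R ^+ 2 / 4 - eps))
  /\
  (exists Omega : set 'rV[R]_n.+1, hyperbolic_domain Omega /\
   exists2 eps0 : R, 0 < eps0 &
   forall eps : R, 0 < eps < eps0 ->
   ~ hardy_inequality Omega 0 (n.+1%:R ^+ 2 / 4 - eps)).
Proof.
split.
  move=> Omega [[oO _ _] _ _ [gamma g0 sub]] eps e0.
  exact: hardy_hyperbolic oO g0 sub e0.
exists (paraboloid (- 5)); split.
  by apply: hyperbolic_paraboloid; rewrite ltrNl oppr0.
exists (n%:R / 10 - 256 / 10000).
  have n1 : (1 : R) <= n%:R by rewrite ler1n.
  by move: n1; lra.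
by move=> eps /andP[_ he]; exact: hardy_fails.
Qed.
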